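(* Let $\alpha\in\mathbb R$, let $M\ge1$ be an integer and let $\hat\mu_1\in\mathrm M_1(\mathsf T)$. Given a sequence of positive learning rates $(\eta_n)$, let $(\hat\mu_n)_{n\ge1}$ be defined by $$\frac{d\hat\mu_{n+1}}{d\hat\mu_n}\propto e^{-\eta_n\hat b_{\hat\mu_n,\alpha,M}},\qquad n\ge1,$$ with $\hat b_{\hat\mu_n,\alpha,M}$ the random functions defined in the context, and, for a given $N\ge1$, set $w_n=\eta_n/\sum_{i=1}^N\eta_i$ for $1\le n\le N$. Assume that $$B_\alpha:=\left(\sup_{\mu\in\mathrm M_1(\mathsf T)}\int_{\mathsf Y}\sup_{\theta,\theta'\in\mathsf T}\frac{k(\theta,y)^2}{k(\theta',y)}\left|f_\alpha'\left(\frac{\mu k(y)}{p(y)}\right)\right|^2\nu(dy)\right)^{1/2}<\infty,$$ and let $\mu^\star\in\mathrm M_{1,\hat\mu_1}(\mathsf T)$ be such that $\Psi_\alpha(\mu^\star)=\inf_{\zeta\in\mathrm M_{1,\hat\mu_1}(\mathsf T)}\Psi_\alpha(\zeta)$. Then for any integer $N\ge1$, $$\mathbb E\left[\Psi_\alpha\left(\sum_{n=1}^Nw_n\hat\mu_n\right)-\Psi_\alpha(\mu^\star)\right]\le\frac{B_\alpha^2\sum_{n=1}^N\eta_n^2/2}{\sum_{n=1}^N\eta_n}+\frac{KL(\mu^\star\|\hat\mu_1)}{\sum_{n=1}^N\eta_n}.$$ In particular, the decreasing policy $\eta_n=\eta_0/\sqrt n$ yields an $O(\log(N)/\sqrt N)$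 bound on the left-hand side. Furthermore, the constant policy $\eta_n=\eta_0/\sqrt N$ yields an $O(1/\sqrt N)$ bound (the right-hand side above), which is minimal for $\eta_0=B_\alpha^{-1}\sqrt{2KL(\mu^\star\|\hat\mu_1)}$.
   Context: Setting. $(\mathsf T,\mathcal T)$ is a measurable space and $\mathrm M_1(\mathsf T)$ is the set of probability measures on it; $\mathrm M_{1,\hat\mu_1}(\mathsf T)$ is the set of probability measures on $\mathsf T$ dominated by $\hat\mu_1$. $(\mathsf Y,\mathcal Y,\nu)$ is a measured space with $\nu$ $\sigma$-finite. $k$ is a kernel density on $\mathsf T\times\mathsf Y$, i.e. $K(\theta,A)=\int_A k(\theta,y)\,\nu(dy)$ is a Markov transition kernel on $\mathsf T\times\mathcal Y$. $p$ is a measurable function on $\mathsf Y$. It is assumed that $k(\theta,y)>0$ and $p(y)>0$ for all $(\theta,y)$, and $\int_{\mathsf Y}p\,d\nu<\infty$. On $(0,\infty)$: $f_0(u)=u-1-\log u$, $f_1(u)=1-u+u\log u$, and $f_\alpha(u)=\frac{1}{\alpha(\alpha-1)}[u^\alpha-1-\alpha(u-1)]$ for $\alpha\in\mathbb R\setminus\{0,1\}$. For $\mu\in\mathrm M_1(\mathsf T)$: $\mu k(y)=\int_{\mathsf T}\mu(d\theta)k(\theta,y)$; $\Psi_\alpha(\mu)=\int_{\mathsf Y}f_\alpha\left(\frac{\mu k(y)}{p(y)}\right)p(y)\,\nu(dy)$; $b_{\mu,\alpha}(\theta)=\int_{\mathsf Y}k(\theta,y)f_\alpha'\left(\frac{\mu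 k(y)}{p(y)}\right)\nu(dy)$. When $\alpha=1$ it is assumed that $b_{\mu,1}(\theta)$ is finite for all $\mu,\theta$. $KL(\mu^\star\|\hat\mu_1)=\int_{\mathsf T}\log\left(\frac{d\mu^\star}{d\hat\mu_1}\right)d\mu^\star$. Random functions: on a probability space $(\Omega,\mathcal F,\mathbb P)$ with expectation $\mathbb E$, let $\mathcal F_1$ be trivial and $\mathcal F_n=\sigma(Y_{1,2},\dots,Y_{M,2},\dots,Y_{1,n},\dots,Y_{M,n})$ for $n\ge2$. Conditionally on $\mathcal F_n$, $Y_{1,n+1},\dots,Y_{M,n+1}$ are i.i.d. with density $\hat\mu_nk$ with respect to $\nu$, and $$\hat b_{\hat\mu_n,\alpha,M}(\theta)=\frac1M\sum_{m=1}^M\frac{k(\theta,Y_{m,n+1})}{\hat\mu_nk(Y_{m,n+1})}f_\alpha'\left(\frac{\hat\mu_nk(Y_{m,n+1})}{p(Y_{m,n+1})}\right).$$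
   Formalization: The two O(·) bounds are stated for KL(μ*‖μ̂₁) < ∞ (otherwise the right-hand side is infinite), and the minimality of η₀ for B_α > 0 and 0 < KL(μ*‖μ̂₁) < ∞ (otherwise that η₀ is not a well-defined positive learning rate). *)

(* Defs.v *)
From HB Require Import structures.
From mathcomp Require Import all_boot all_order all_algebra.
From mathcomp Require Import all_classical all_reals all_analysis.
From mathcomp Require Import measurable_realfun.

Set Implicit Arguments.
Unset Strict Implicit.
Unset Printing Implicit Defensive.

Import Order.TTheory GRing.Theory Num.Theory.
Import numFieldNormedType.Exports.

Local Open Scope classical_set_scope.
Local Open Scope ring_scope.

Definition falpha (R : realType) (alpha u : R) : R :=
  if alpha == 0 then u - 1 - ln u
  else if alpha == 1 then 1 - u + u * ln u
  else (alpha * (alpha - 1))^-1 * (u `^ alpha - 1 - alpha * (u - 1)).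

(* The measure [A |-> \int_A e^(- eta * b) d mu]. *)
Definition exp_weighted d (T : measurableType d) (R : realType)
    (mu : {measure set T -> \bar R}) (eta : R) (b : {mfun T >-> R})
    (A : set T) : \bar R :=
  (\int[mu]_(t in A) (expR (- eta * b t))%:E)%E.

Section exp_weighted_measure.
Context d (T : measurableType d) (R : realType).
Context (mu : {measure set T -> \bar R}) (eta : R) (b : {mfun T >-> R}).

Let exp_weighted0 : exp_weighted mu eta b set0 = 0%E.
Proof. by rewrite /exp_weighted integral_set0. Qed.

Let exp_weighted_ge0 A : (0 <= exp_weighted mu eta b A)%E.
Proof. by apply: integral_ge0 => t _; rewrite lee_fin expR_ge0. Qed.

Let exp_weighted_sigma_additive : semi_sigma_additive (exp_weighted mu eta b).
Proof.
move=> F mF tF mUF; rewrite /exp_weighted ge0_integral_bigcup//.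
- apply: is_cvg_ereal_nneg_natsum_cond => n _ _.
  by apply: integral_ge0 => t _; rewrite lee_fin expR_ge0.
- apply/measurable_funTS/measurable_EFinP.
  by apply: measurableT_comp => //; exact: measurable_funM.
Qed.

HB.instance Definition _ := isMeasure.Build _ _ _ (exp_weighted mu eta b)
  exp_weighted0 exp_weighted_ge0 exp_weighted_sigma_additive.

End exp_weighted_measure.

Section model.
Context (R : realType) (dT dY : measure_display).
Context (T : measurableType dT) (Y : measurableType dY).
Context (nu : {sigma_finite_measure set Y -> \bar R}).
Context (k : {mfun (T * Y)%type >-> R}) (p : Y -> R) (alpha : R).

(* [mu k (y)]; for a probability measure [mu] the integral is finite for
   [nu]-almost every [y], and [fine] returns 0 on the exceptional null set. *)
Definition mixk (mu : set T -> \bar R) (y : Y) : R :=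
  fine (\int[mu]_t (k (t, y))%:E).

Definition Psi (mu : set T -> \bar R) : \bar R :=
  (\int[nu]_y (falpha alpha (mixk mu y / p y) * p y)%:E)%E.

Definition balpha (mu : set T -> \bar R) (t : T) : \bar R :=
  (\int[nu]_y (k (t, y) * derive1 (falpha alpha) (mixk mu y / p y))%:E)%E.

Definition Balpha : \bar R :=
  sqrte (ereal_sup (range (fun mu : probability T R =>
    \int[nu]_y ereal_sup [set
      (k (t, y) ^+ 2 / k (t', y)
        * `|derive1 (falpha alpha) (mixk mu y / p y)| ^+ 2)%:E
      | t in [set: T] & t' in [set: T]])))%E.

Definition bhat (M : nat) (mu : set T -> \bar R) (ys : 'I_M -> Y) (t : T) : R :=
  M%:R^-1 * \sum_(m < M) k (t, ys m) / mixk mu (ys m)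
                         * derive1 (falpha alpha) (mixk mu (ys m) / p (ys m)).

Lemma measurable_bhat M mu (ys : 'I_M -> Y) :
  measurable_fun [set: T] (bhat mu ys).
Proof.
apply: measurable_funM => //; apply: measurable_sum => m.
apply: measurable_funM => //; apply: measurable_funM => //.
exact: (measurableT_comp (measurable_funPT k) (pair2_measurable _)).
Qed.

HB.instance Definition _ M mu (ys : 'I_M -> Y) :=
  isMeasurableFun.Build _ _ _ _ (bhat mu ys) (measurable_bhat mu ys).

(* [d muhat_(n+1) / d muhat_n] is proportional to [e^(- eta_n bhat_n)]; the
   indices start at 1, and the value at 0 is never used. On the negligible event
   that the normalizing constant is infinite, [mnormalize] returns its second
   argument. *)
Fixpoint muhat (M : nat) (mu1 : probability T R) (eta : nat -> R)
    (dO : measure_display) (Omega : measurableType dO)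
    (Ys : 'I_M -> nat -> Omega -> Y) (n : nat) (w : Omega) : probability T R :=
  match n with
  | n'.+1 =>
    if n' is 0 then mu1 else
    let mu := muhat mu1 eta Ys n' w in
    mnormalize (exp_weighted mu (eta n') (bhat mu (fun m => Ys m n'.+1 w))) mu
  | 0 => mu1
  end.

End model.

(* A generating family of the sigma-algebra [F_n]. *)
Definition past_events (dO dY : measure_display) (Omega : measurableType dO)
    (Y : measurableType dY) (M : nat) (Ys : 'I_M -> nat -> Omega -> Y)
    (n : nat) : set (set Omega) :=
  [set B | exists m i A,
    [/\ (2 <= i <= n)%N, measurable A & B = Ys m i @^-1` A]].

(* [q] is a version of [P(E | sigma(G))]. *)
Definition cond_prob (R : realType) (dO : measure_display)
    (Omega : measurableType dO) (P : probability Omega R)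
    (G : set (set Omega)) (E : set Omega) (q : Omega -> \bar R) : Prop :=
  measurable_fun [set: g_sigma_algebraType G] q /\
  forall F, <<s G >> F -> (P (F `&` E) = \int[P]_(w in F) q w)%E.

(* Conditionally on [F_n], the variables [Y_(1,n+1), ..., Y_(M,n+1)] are
   i.i.d. with density [muhat_n k] with respect to [nu]. *)
Definition cond_iid_sampling (R : realType) (dT dY dO : measure_display)
    (T : measurableType dT) (Y : measurableType dY) (Omega : measurableType dO)
    (nu : {sigma_finite_measure set Y -> \bar R})
    (k : {mfun (T * Y)%type >-> R}) (p : Y -> R) (alpha : R) (M : nat)
    (mu1 : probability T R) (eta : nat -> R) (P : probability Omega R)
    (Ys : 'I_M -> nat -> {RV P >-> Y}) : Prop :=
  forall n, (0 < n)%N -> forall A : 'I_M -> set Y,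
  (forall m, measurable (A m)) ->
  cond_prob P (past_events Ys n) (\bigcap_m (Ys m n.+1 @^-1` A m))
    (fun w => \prod_(m < M) \int[nu]_(y in A m)
       (mixk k (muhat k p alpha mu1 eta Ys n w) y)%:E)%E.

(* [\sum_(n = 1)^N w_n mu_n] with [w_n = eta_n / \sum_(i = 1)^N eta_i]. *)
Definition weighted_average (R : realType) (dT : measure_display)
    (T : measurableType dT) (eta : nat -> R) (mu : nat -> probability T R)
    (N : nat) (A : set T) : \bar R :=
  (\sum_(1 <= n < N.+1)
     (eta n / \sum_(1 <= i < N.+1) eta i)%:E * mu n A)%E.

Definition expected_gap (R : realType) (dT dY dO : measure_display)
    (T : measurableType dT) (Y : measurableType dY) (Omega : measurableType dO)
    (nu : {sigma_finite_measure set Y -> \bar R})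
    (k : {mfun (T * Y)%type >-> R}) (p : Y -> R) (alpha : R) (M : nat)
    (mu1 mustar : probability T R) (eta : nat -> R) (P : probability Omega R)
    (Ys : 'I_M -> nat -> Omega -> Y) (N : nat) : \bar R :=
  (\int[P]_w
     (Psi nu k p alpha
        (weighted_average eta (fun n => muhat k p alpha mu1 eta Ys n w) N)
      - Psi nu k p alpha mustar))%E.

Definition KL (R : realType) (d : measure_display) (T : measurableType d)
    (mu1 mu2 : probability T R) : \bar R :=
  (\int[mu1]_t lne (Radon_Nikodym (charge_of_finite_measure mu1) mu2 t))%E.

Definition gap_bound (R : realType) (B KLstar : \bar R) (eta : nat -> R)
    (N : nat) : \bar R :=
  ((B ^+ 2 * (\sum_(1 <= n < N.+1) eta n ^+ 2 / 2)%:E)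
     * ((\sum_(1 <= n < N.+1) eta n)^-1)%:E
   + KLstar * ((\sum_(1 <= n < N.+1) eta n)^-1)%:E)%E.

Definition decreasing_policy (R : realType) (eta0 : R) (n : nat) : R :=
  eta0 / Num.sqrt n%:R.

Definition constant_policy (R : realType) (eta0 : R) (N n : nat) : R :=
  eta0 / Num.sqrt N%:R.

(* Main.v *)
Require Import Defs.
From HB Require Import structures.
From mathcomp Require Import all_boot all_order all_algebra.
From mathcomp Require Import all_classical all_reals all_analysis.
From mathcomp Require Import measurable_realfun ess_sup_inf ring lra.

(** The tangent inequality for the convex function [falpha] bounds the gap
    [Psi (sum_n w_n mu_n) - Psi mustar] by [sum_n w_n <b_n, mu_n - mustar>],
    and [bhat_n] is conditionally unbiased for [b_n] given the past. Along every
    sample path, Hoeffding's lemma bounds the log-normalizer of the [n]-th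
    exponential-weights step by [(eta_n s_n)^2 / 2 - eta_n <bhat_n, mu_n>], where
    [s_n] is the essential supremum of [|bhat_n|] under [mu1]; integrating the
    log-density of [mu_(N+1)] with respect to [mu1] against [mustar] and comparing
    it with [KL mustar mu1] gives the regret bound
    [sum_n eta_n <bhat_n, mu_n - mustar> <= KL mustar mu1 + sum_n eta_n^2 s_n^2 / 2].
    Taking expectations concludes, since [E s_n^2 <= Balpha^2]. *)

Set Implicit Arguments.
Unset Strict Implicit.
Unset Printing Implicit Defensive.

Import Order.TTheory GRing.Theory Num.Theory.
Import numFieldNormedType.Exports.

Local Open Scope classical_set_scope.
Local Open Scope ring_scope.

(** * Convexity of the alpha-divergence generators and Hoeffding's bound *)

(** The last estimate holds for the following reason. For one draw y with density q = muhat_n k, a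
    summand of [bhat] is k(t,y) f'(q/p) / q. If G(y) is the supremum inside [Balpha], then k(t,y)^2
    f'(q/p)^2 <= G(y) k(t',y) for all t, t'. Integrating in t' under muhat_n replaces k(t',y) by q,
    so the squared summand times q is at most G(y), uniformly in t. That weight q is the sampling
    density, so the expectation is at most the integral of G. The factor 1/2 is Hoeffding's (2s)^2/8
    for values in [-s, s]. Two obstacles shape the proof. Mixtures, suprema and normalizers may be
    infinite on exceptional paths, so pathwise bounds live in the extended reals, where an infinite
    right-hand side is harmless. Taking conditional expectations needs muhat_n to depend measurably
    on the past, so each [muhat] is handled through its density with respect to the fixed measure
    [mu1]. *)

Lemma expR_tangent_le (R : realType) (a c : R) :
  expR c * (1 + (a - c)) <= expR a.
Proof.
rewrite -[in leRHS](subrK c a) expRD mulrC ler_wpM2r ?expR_ge0//.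
exact: expR_ge1Dx.
Qed.

(** Average over the two points of the tangent at their barycentre [c]; the linear terms cancel. *)
Lemma expR_jensen2 (R : realType) (w a b : R) : 0 <= w -> w <= 1 ->
  expR (w * a + (1 - w) * b) <= w * expR a + (1 - w) * expR b.
Proof.
move=> w0 w1; set c := _ + _.
have -> : expR c = w * (expR c * (1 + (a - c)))
                   + (1 - w) * (expR c * (1 + (b - c))).
  by rewrite /c; ring.
by apply: lerD; rewrite ler_wpM2l ?subr_ge0// expR_tangent_le.
Qed.

Lemma ln_le_subr1 (R : realType) (x : R) : 0 < x -> ln x <= x - 1.
Proof.
move=> x0; have /le_ln1Dx : -1 < x - 1 by lra.
by rewrite addrC subrK.
Qed.

(** A total, measurable stand-in for [derive1 (falpha alpha)], with which it agrees at positive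
    arguments. *)
Definition dfalpha (R : realType) (alpha u : R) : R :=
  if alpha == 0 then 1 - u^-1
  else if alpha == 1 then ln u
  else (alpha - 1)^-1 * (u `^ (alpha - 1) - 1).

Lemma is_derive_falpha (R : realType) (alpha u : R) : 0 < u ->
  is_derive u 1 (falpha alpha) (dfalpha alpha u).
Proof.
move=> u0; rewrite /dfalpha.
have dln := is_derive1_ln u0.
have [a0|a0] := eqVneq alpha 0.
  have -> : falpha alpha = (id \- cst 1) \- @ln R.
    by apply/funext => x; rewrite /falpha a0 eqxx.
  by apply: is_derive_eq; rewrite subr0.
have [a1|a1] := eqVneq alpha 1.
  have -> : falpha alpha = (cst 1 \- id) \+ (id \* @ln R).
    by apply/funext => x; rewrite /falpha a1 oner_eq0 eqxx.
  apply: is_derive_eq; rewrite /= !scaler1 /= [u *: _]mulfV ?gt_eqF//.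
  by ring.
have -> : falpha alpha = (alpha * (alpha - 1))^-1 \*:
    (((@powR R)^~ alpha \- cst 1) \- alpha \*: (id \- cst 1)).
  apply/funext => x; rewrite /falpha (negPf a0) (negPf a1) /=.
  by [].
have dpow := is_derive1_powR alpha u0.
apply: is_derive_eq; rewrite !subr0 /= /GRing.scale /=.
have ? : alpha - 1 != 0 by rewrite subr_eq0.
by field; apply/andP.
Qed.

Lemma derive1_falpha (R : realType) (alpha u : R) : 0 < u ->
  derive1 (falpha alpha) u = dfalpha alpha u.
Proof.
by move=> u0; rewrite derive1E; have := is_derive_falpha alpha u0 => dH;
  rewrite derive_val.
Qed.

(** With t = exp s this is two-point convexity of the exponential: among 0, s and alpha s, the
    middle point is a convex combination of the outer two. Which one is in the middle depends on the
    position of alpha relative to 0 and 1, and so does the sign of the prefactor. *)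
Lemma powR_bernoulli (R : realType) (alpha t : R) : 0 < t ->
  alpha != 0 -> alpha != 1 ->
  0 <= (alpha * (alpha - 1))^-1 * (t `^ alpha - 1 - alpha * (t - 1)).
Proof.
move=> t0 a0 a1; rewrite /powR gt_eqF//.
set s := ln t; have -> : t = expR s by rewrite lnK.
have [a_lt0|a_ge0] := ltP alpha 0.
  rewrite mulr_ge0// ?invr_ge0; first by nra.
  have d0 : 0 < 1 - alpha by lra.
  have := @expR_jensen2 R (1 - alpha)^-1 (alpha * s) s.
  rewrite invr_ge0 invf_le1// (ltW d0) => /(_ isT).
  have -> : (1 - alpha)^-1 * (alpha * s) + (1 - (1 - alpha)^-1) * s = 0.
    by field; rewrite gt_eqF.
  rewrite expR0 => /(_ ltac:(lra)).
  rewrite -(ler_pM2l d0) mulrDr !mulrA mulfV ?gt_eqF// mulrBr mulfV ?gt_eqF//.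
  by lra.
have {a_ge0} a_gt0 : 0 < alpha by rewrite lt_neqAle eq_sym a0.
have [a_lt1|a_ge1] := ltP alpha 1.
  have := @expR_jensen2 R alpha s 0 (ltW a_gt0) (ltW a_lt1).
  rewrite mulr0 addr0 expR0 => H.
  rewrite mulr_le0// ?invr_le0; [by nra | by lra].
have {a_ge1} a_gt1 : 1 < alpha by rewrite lt_neqAle eq_sym a1.
rewrite mulr_ge0// ?invr_ge0; first by nra.
have := @expR_jensen2 R alpha^-1 (alpha * s) 0.
rewrite invr_ge0 invf_le1// (ltW a_gt0) (ltW a_gt1) => /(_ isT isT).
rewrite mulr0 addr0 expR0 mulrA mulVf// mul1r -(ler_pM2l a_gt0).
rewrite mulrDr !mulrA mulfV// mulrBr mulfV//.
by lra.
Qed.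

(** The gap between [falpha] and its tangent at v equals v^alpha times [falpha alpha (u / v)], so
    everything reduces to the sign of the generator at u / v: ln x <= x - 1 when alpha is 0 or 1,
    [powR_bernoulli] otherwise. *)
Lemma falpha_tangent_le (R : realType) (alpha u v : R) : 0 < u -> 0 < v ->
  falpha alpha v + dfalpha alpha v * (u - v) <= falpha alpha u.
Proof.
move=> u0 v0; rewrite /falpha /dfalpha.
have t0 : 0 < u / v by rewrite divr_gt0.
case: ifPn => [_|a0].
  have := ln_le_subr1 t0; rewrite ln_div ?posrE//.
  rewrite mulrBl mul1r mulrBr mulVf ?gt_eqF//.
  by rewrite (mulrC u); lra.
case: ifPn => [_|a1].
  have := ln_le_subr1 (divr_gt0 v0 u0); rewrite ln_div ?posrE//.
  rewrite -(ler_pM2l u0) !mulrBr mulrCA mulfV ?gt_eqF// !mulr1.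
  by lra.
have := powR_bernoulli t0 a0 a1.
have va0 : 0 < v `^ alpha by rewrite powR_gt0.
rewrite -(pmulr_rge0 _ va0) => H; rewrite -subr_ge0.
have -> : v `^ (alpha - 1) = v `^ alpha / v.
  by rewrite powRB ?powRr1 ?ltW// ?(gt_eqF v0) ?implybT.
have -> : u `^ alpha = v `^ alpha * (u / v) `^ alpha.
  by rewrite -powRM ?ltW// mulrCA mulfV ?gt_eqF// mulr1.
apply: (le_trans H); rewrite le_eqVlt; apply/orP; left; apply/eqP.
have ? : alpha - 1 != 0 by rewrite subr_eq0.
by field; rewrite gt_eqF//=; apply/andP.
Qed.

Lemma dfalpha1 (R : realType) (alpha : R) : dfalpha alpha 1 = 0.
Proof.
by rewrite /dfalpha; (case: ifP => _; [|case: ifP => _]);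
  rewrite ?invr1 ?ln1 ?powR1 ?subrr ?mulr0.
Qed.

Lemma falpha1 (R : realType) (alpha : R) : falpha alpha 1 = 0.
Proof.
by rewrite /falpha; (case: ifP => _; [|case: ifP => _]);
  rewrite ?ln1 ?powR1 ?subrr ?mulr0 ?subrr ?addr0 ?mulr0.
Qed.

Lemma falpha_ge0 (R : realType) (alpha u : R) : 0 < u -> 0 <= falpha alpha u.
Proof.
move=> u0; have := falpha_tangent_le alpha u0 ltr01.
by rewrite falpha1 dfalpha1 mul0r addr0.
Qed.

Lemma measurable_falpha (R : realType) (alpha : R) :
  measurable_fun [set: R] (falpha alpha).
Proof.
rewrite /falpha; case: (alpha == 0).
  by apply: measurable_funB; [exact: measurable_funB|exact: measurable_ln].
case: (alpha == 1).
  apply: measurable_funD; first exact: measurable_funB.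
  by apply: measurable_funM => //; exact: measurable_ln.
apply: measurable_funM => //; apply: measurable_funB.
  by apply: measurable_funB => //; exact: measurable_powR.
by apply: measurable_funM => //; exact: measurable_funB.
Qed.

Lemma measurable_invr (R : realType) : measurable_fun [set: R] (@GRing.inv R).
Proof.
(* The square makes the base nonnegative, where the power -1 is the inverse; at 0 the prefactor
   gives the conventional value 0. *)
have -> : @GRing.inv R = (fun x => x * (x ^+ 2) `^ (-1)).
  apply/funext => x; rewrite powR_inv1 ?sqr_ge0//.
  have [->|x0] := eqVneq x 0; first by rewrite invr0 mul0r.
  by rewrite expr2 invfM mulrA mulfV// mul1r.
apply: measurable_funM => //.
apply: (@measurableT_comp _ _ _ _ _ _ (fun x : R => x `^ (-1))).
  exact: measurable_powR.
exact: measurable_funX.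
Qed.

Lemma measurable_dfalpha (R : realType) (alpha : R) :
  measurable_fun [set: R] (dfalpha alpha).
Proof.
rewrite /dfalpha; case: (alpha == 0).
  by apply: measurable_funB => //; exact: measurable_invr.
case: (alpha == 1); first exact: measurable_ln.
by apply: measurable_funM => //; apply: measurable_funB => //;
  exact: measurable_powR.
Qed.

(* For [psi x = N x / D x] with [D = cosh - a sinh] and [N = D'], one has
   [psi' = 1 - psi ^ 2 <= 1] and [psi 0 = - a], so
   [x ^ 2 / 2 - a x - ln (D x)] has a nondecreasing derivative vanishing at 0. *)
Lemma hoeffding_cosh_sinh (R : realType) (a x : R) : -1 <= a <= 1 -> 0 <= x ->
  (expR x + expR (- x)) / 2 - a * ((expR x - expR (- x)) / 2)
  <= expR (x ^+ 2 / 2 - a * x).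
Proof.
move=> /andP[a_ge a_le] x_ge0.
pose D : R -> R := fun t => (1 - a) / 2 * expR t + (1 + a) / 2 * expR (- t).
pose N : R -> R := fun t => (1 - a) / 2 * expR t - (1 + a) / 2 * expR (- t).
have D0 t : 0 < D t.
  rewrite /D; have := expR_gt0 t; have := expR_gt0 (- t) => e1 e2.
  have [a1|a1] := ltP a 1.
    by rewrite ltr_pwDl// ?mulr_ge0 ?mulr_gt0//; lra.
  by rewrite ltr_wpDl// ?mulr_ge0 ?mulr_gt0//; lra.
have dexpN (t : R) : is_derive t 1 (fun y : R => expR (- y)) (- expR (- t)).
  have -> : (fun y : R => expR (- y)) = @expR R \o (-%R) by [].
  by apply: is_derive_eq; rewrite /GRing.scale /=; ring.
have dexp (t : R) : is_derive t 1 (@expR R) (expR t).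
  exact: is_derive_expR.
have dD (t : R) : is_derive t 1 D (N t).
  have -> : D = ((1 - a) / 2) \*: @expR R \+ ((1 + a) / 2) \*: (fun y : R => expR (- y)).
    by [].
  by apply: is_derive_eq; rewrite /N /GRing.scale /=; ring.
have dN (t : R) : is_derive t 1 N (D t).
  have -> : N = ((1 - a) / 2) \*: @expR R \- ((1 + a) / 2) \*: (fun y : R => expR (- y)).
    by [].
  by apply: is_derive_eq; rewrite /D /GRing.scale /=; ring.
pose psi : R -> R := fun t => t - a - N t / D t.
have dpsi (t : R) : is_derive t 1 psi ((N t / D t) ^+ 2).
  have -> : psi = (id \- cst a) \- (N \* (fun y => (D y)^-1)) by [].
  have Dneq : D t != 0 by rewrite gt_eqF.
  have dV : is_derive t 1 (fun y => (D y)^-1) (- (D t) ^- 2 *: N t).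
    exact: is_deriveV.
  by apply: is_derive_eq; rewrite /GRing.scale /= subr0 expr2; field.
have psi0 : psi 0 = 0.
  by rewrite /psi /N /D oppr0 expR0; field; lra.
have psi_ge0 t : 0 <= t -> 0 <= psi t.
  rewrite le_eqVlt => /predU1P[<-|t0]; first by rewrite psi0.
  have [|c _ H] := @MVT R psi (fun t => (N t / D t) ^+ 2) 0 t t0 (fun y _ => dpsi y).
    apply: continuous_subspaceT => y; apply/differentiable_continuous.
    by apply/derivable1_diffP; have := dpsi y => -[].
  by move: H; rewrite psi0 !subr0 => ->; rewrite mulr_ge0// ?sqr_ge0// ltW.
pose h : R -> R := fun t => t ^+ 2 / 2 - a * t - ln (D t).
have dh (t : R) : is_derive t 1 h (psi t).
  have -> : h = ((2^-1 \*: (id \* id)) \- a \*: id) \- (@ln R \o D).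
    by apply/funext => y; rewrite /h /= /GRing.scale /= expr2 (mulrC 2^-1).
  have := is_derive1_ln (D0 t) => dln.
  by apply: is_derive_eq; rewrite /psi /GRing.scale /=; field; rewrite gt_eqF.
have h_ge0 : 0 <= h x.
  move: x_ge0; rewrite le_eqVlt => /predU1P[<-|x0].
    by rewrite /h /D oppr0 expR0 expr0n /= mul0r mulr0 !mulr1 -mulrDl addrCA subrK
      divff// ln1 !subr0.
  have [|c c0 H] := @MVT R h psi 0 x x0 (fun y _ => dh y).
    apply: continuous_subspaceT => y; apply/differentiable_continuous.
    by apply/derivable1_diffP; have := dh y => -[].
  have h0 : h 0 = 0.
    rewrite /h /D oppr0 expR0 expr0n /= mul0r mulr0 !mulr1 -mulrDl.
    by rewrite (_ : 1 - a + (1 + a) = 2) ?divff// ?ln1 ?subr0//; ring.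
  move: H; rewrite h0 !subr0 => ->; rewrite mulr_ge0 ?(ltW x0)// psi_ge0//.
  by move: c0; rewrite in_itv /= => /andP[/ltW].
have -> : (expR x + expR (- x)) / 2 - a * ((expR x - expR (- x)) / 2) = D x.
  by rewrite /D; field.
by rewrite -[D x]lnK ?posrE// ler_expR; move: h_ge0; rewrite /h; lra.
Qed.

(** By convexity the exponential lies below its chord over [-s, s]. The chord is affine in x, so its
    integral depends on the mean alone. *)
Lemma expR_chord (R : realType) (s x : R) : `|x| <= s ->
  expR (- x) <= (expR s + expR (- s)) / 2 - x / s * ((expR s - expR (- s)) / 2).
Proof.
(* For s = 0 only x = 0 remains, and [x / s] is 0 by convention. *)
move=> xs; have [s0|s0] := eqVneq s 0.
  move: xs; rewrite s0 normr_le0 => /eqP ->.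
  by rewrite mul0r oppr0 expR0; lra.
have {}s0 : 0 < s by rewrite lt_neqAle eq_sym s0 (le_trans _ xs).
have /andP[x_ge x_le] : - s <= x <= s by rewrite -ler_norml.
have := @expR_jensen2 R ((1 - x / s) / 2) s (- s).
have -> : (1 - x / s) / 2 * s + (1 - (1 - x / s) / 2) * - s = - x.
  by field; rewrite gt_eqF.
have xs_le : x / s <= 1 by rewrite ler_pdivrMr// mul1r.
have xs_ge : - 1 <= x / s by rewrite ler_pdivlMr// mulN1r.
by move=> /(_ ltac:(lra) ltac:(lra)); lra.
Qed.

(** * Integration without measurability, densities, essential suprema *)

(* No measurability is required: the integral of a nonnegative function is
   defined as a supremum over simple functions. This matters for [Balpha], whose
   integrand may fail to be measurable. *)
Section le_integral_pointwise.
Import HBNNSimple.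

Lemma le_integral_pointwise d (T : measurableType d) (R : realType)
    (mu : {measure set T -> \bar R}) (f g : T -> \bar R) :
  (forall x, (f x <= g x)%E) -> (\int[mu]_x f x <= \int[mu]_x g x)%E.
Proof.
move=> fg.
have le_ge0 (u v : T -> \bar R) : (forall x, 0 <= u x)%E ->
    (forall x, u x <= v x)%E -> (\int[mu]_x u x <= \int[mu]_x v x)%E.
  move=> u0 uv; have v0 x : (0 <= v x)%E by rewrite (le_trans (u0 x)).
  rewrite !ge0_integralTE//; apply: le_ereal_sup => _ [h hu <-].
  by exists h => // x; rewrite (le_trans (hu x)).
rewrite integralE [leRHS]integralE; apply: leeB; apply: le_ge0 => // x.
  by apply: (@funepos_le _ _ setT) => //; rewrite inE.
by apply: (@funeneg_le _ _ setT) => //; rewrite inE.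
Qed.

End le_integral_pointwise.

(** Signs are arbitrary: positive and negative parts are compared separately, and extended
    subtraction is monotone even at infinite values. *)
Lemma ae_le_integral d (T : measurableType d) (R : realType)
    (mu : {measure set T -> \bar R}) (f g : T -> \bar R) :
  measurable_fun [set: T] f -> measurable_fun [set: T] g ->
  (\forall x \ae mu, (f x <= g x)%E) -> (\int[mu]_x f x <= \int[mu]_x g x)%E.
Proof.
move=> mf mg fg; rewrite integralE [leRHS]integralE; apply: leeB.
  apply: ae_ge0_le_integral => //; [exact: measurable_funepos..|].
  apply: filterS fg => x fgx _.
  by rewrite !funeposE ge_max !le_max fgx lexx orbT.
apply: ae_ge0_le_integral => //; [exact: measurable_funeneg..|].
apply: filterS fg => x fgx _.
by rewrite !funenegE ge_max !le_max leeN2 fgx lexx orbT.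
Qed.

Section density.
Local Open Scope ereal_scope.
Context d (T : measurableType d) (R : realType).
Variables (mu : {measure set T -> \bar R}) (q : T -> R).
Hypotheses (mq : measurable_fun [set: T] q) (q_ge0 : forall x, (0 <= q x)%R).

Definition mdensity (A : set T) : \bar R := \int[mu]_(x in A) (q x)%:E.

Let mdensity0 : mdensity set0 = 0%E.
Proof. by rewrite /mdensity integral_set0. Qed.

Let mdensity_ge0 A : (0 <= mdensity A)%E.
Proof. by apply: integral_ge0 => t _; rewrite lee_fin. Qed.

Let mdensity_sigma_additive : semi_sigma_additive mdensity.
Proof.
move=> F mF tF mUF; rewrite /mdensity ge0_integral_bigcup//.
- apply: is_cvg_ereal_nneg_natsum_cond => n _ _.
  by apply: integral_ge0 => t _; rewrite lee_fin.
- exact/measurable_funTS/measurable_EFinP.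
- by move=> t _; rewrite lee_fin.
Qed.

(** Packed by hand because the measure axioms depend on the section hypotheses on [q]; it feeds the
    uniqueness theorem for measures used for joint laws. *)
Definition mdensity_measure : {measure set T -> \bar R} :=
  HB.pack mdensity (isMeasure.Build _ _ _ mdensity
    mdensity0 mdensity_ge0 mdensity_sigma_additive).

Import HBNNSimple.

(** [m] is any measure agreeing with the density on measurable sets, so exponential weights,
    Radon-Nikodym densities and joint laws all fit. Indicators are the hypothesis; simple functions
    and monotone convergence do the rest. *)
Lemma ge0_integral_density (m : {measure set T -> \bar R}) (f : T -> \bar R) :
  (forall A, measurable A -> m A = \int[mu]_(x in A) (q x)%:E) ->
  measurable_fun [set: T] f -> (forall x, 0 <= f x) ->
  \int[m]_x f x = \int[mu]_x (f x * (q x)%:E).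
Proof.
move=> mE mf f0; pose f_ := nnsfun_approx measurableT mf.
have mEq : measurable_fun [set: T] (EFin \o q) by exact/measurable_EFinP.
transitivity (limn (fun n => \int[m]_x (f_ n x)%:E)).
  rewrite -monotone_convergence//=.
  - by apply: eq_integral => x _; apply/esym/cvg_lim => //=;
      apply: cvg_nnsfun_approx.
  - by move=> n; exact/measurable_EFinP.
  - by move=> n x _; rewrite lee_fin.
  - by move=> x _ a b ab; rewrite lee_fin//; exact/lefP/nd_nnsfun_approx.
transitivity (limn (fun n => \int[mu]_x ((f_ n x)%:E * (q x)%:E))); last first.
  rewrite -monotone_convergence//=.
  - apply: eq_integral => x _; apply/cvg_lim => //=.
    by apply: cvgeZr => //; exact: cvg_nnsfun_approx.
  - by move=> n; apply: emeasurable_funM => //; exact/measurable_EFinP.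
  - by move=> n x _; rewrite mule_ge0// lee_fin.
  - move=> x _ a b ab; rewrite lee_wpmul2r ?lee_fin//.
    by exact/lefP/nd_nnsfun_approx.
congr (limn _); apply/funext => n.
under eq_integral do rewrite fimfunE -fsumEFin//.
rewrite ge0_integral_fsum//; last 2 first.
  - by move=> r; exact/measurable_EFinP/measurableT_comp.
  - by move=> r x _; rewrite EFinM nnfun_muleindic_ge0.
under [RHS]eq_integral.
  move=> x _; rewrite fimfunE -fsumEFin// ge0_mule_fsuml; last first.
    by move=> r; rewrite EFinM nnfun_muleindic_ge0.
  over.
rewrite [RHS]ge0_integral_fsum//; last 2 first.
  - move=> r; apply: emeasurable_funM => //.
    by apply/measurable_EFinP; exact: measurableT_comp.
  - move=> r x _; apply: mule_ge0; last by rewrite lee_fin.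
    by rewrite EFinM nnfun_muleindic_ge0.
apply: eq_fsbigr => r; rewrite inE => -[t _ <-].
have m_ : measurable (f_ n @^-1` [set f_ n t]) by [].
rewrite integralZl_indic_nnsfun// integral_indic// setIT mE//.
under [RHS]eq_integral do rewrite EFinM -muleA.
rewrite ge0_integralZl//; last 3 first.
  - by apply: emeasurable_funM => //; exact/measurable_EFinP.
  - by move=> x _; rewrite mule_ge0 ?lee_fin.
  - by rewrite lee_fin.
congr (_ * _); rewrite integral_mkcond; apply: eq_integral => x _.
by rewrite /patch indicE; case: ifPn; rewrite ?mul1e ?mul0e.
Qed.

End density.

(** The essential supremum at y exceeds r exactly when the y-section of {k > r} is not null, and the
    measure of a section is measurable in y. *)
Lemma measurable_ess_sup_curry d1 d2 (T : measurableType d1)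
    (Y : measurableType d2) (R : realType) (mu : probability T R)
    (k : T * Y -> R) : measurable_fun [set: T * Y] k ->
  measurable_fun [set: Y] (fun y => ess_sup mu (fun t => (k (t, y))%:E)).
Proof.
move=> mk; apply: (measurability _ (ErealGenOInfty.measurableE R)) => //.
move=> _ [_ [r ->] <-]; rewrite setTI.
pose A := [set z : T * Y | r < k z].
have mA : measurable A.
  have := mk measurableT `]r, +oo[%classic (measurable_itv _).
  rewrite setTI; congr measurable; apply/seteqP; split=> z /=.
    by rewrite in_itv /= andbT.
  by rewrite /A/= in_itv /= andbT.
have muA : measurable_fun [set: Y] (fun y => mu (ysection A y)).
  exact: measurable_fun_ysection.
have := muA measurableT [set~ 0%E] (measurableC (emeasurable_set1 _)).
rewrite setTI.
congr measurable; apply/seteqP; split=> y /=; rewrite in_itv /= andbT.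
  move=> Ay; rewrite ltNge; apply/negP => /ess_supP H; apply: Ay.
  apply: (negligibleP _ _).1; first exact: measurable_ysection.
  apply: negligibleS H => t /=; rewrite /ysection /= inE /A /= => rk.
  by rewrite lee_fin; apply/negP; rewrite -ltNge.
move=> rS A0; move: rS; rewrite ltNge => /negP; apply; apply/ess_supP.
have /(negligibleP mu (measurable_ysection y mA)) := A0.
apply: negligibleS => t /= /negP; rewrite lee_fin -ltNge => rk.
by rewrite /ysection /= inE.
Qed.

Lemma integral_cst_probability d (T : measurableType d) (R : realType)
    (mu : probability T R) (r : \bar R) : (\int[mu]_t cst r t = r)%E.
Proof. by rewrite integral_cst//= (probability_setT mu) mule1. Qed.

Lemma integrable_ae_bounded d (T : measurableType d) (R : realType)
    (mu : probability T R) (b : T -> R) (s : R) :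
  measurable_fun [set: T] b -> (\forall t \ae mu, `|b t| <= s) ->
  mu.-integrable [set: T] (EFin \o b).
Proof.
move=> mb bs; apply/integrableP; split; first exact/measurable_EFinP.
have : (\int[mu]_t (cst s%:E) t < +oo)%E.
  by rewrite integral_cst_probability ltry.
apply: le_lt_trans; apply: ae_le_integral => //.
  by apply: measurableT_comp => //; exact/measurable_EFinP.
Qed.

Lemma ae_bounded_integral d (T : measurableType d) (R : realType)
    (mu : probability T R) (b : T -> R) (s : R) :
  measurable_fun [set: T] b -> (\forall t \ae mu, `|b t| <= s) ->
  `|fine (\int[mu]_t (b t)%:E)| <= s.
Proof.
move=> mb bs; have ib := integrable_ae_bounded mb bs.
rewrite -lee_fin -abse_EFin fineK; last exact: integrable_fin_num.
apply: (le_trans (le_abse_integral _ _ _)) => //.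
  exact/measurable_EFinP.
have -> : s%:E = (\int[mu]_t (cst s%:E) t)%E.
  by rewrite integral_cst_probability.
apply: ae_le_integral => //.
by apply: measurableT_comp => //; exact/measurable_EFinP.
Qed.

(** [b] is not centred: its mean stays in the exponent and becomes the loss of the current measure
    in the regret bound. *)
Lemma hoeffding_mgf d (T : measurableType d) (R : realType)
    (mu : probability T R) (b : T -> R) (s : R) : 0 <= s ->
  measurable_fun [set: T] b -> (\forall t \ae mu, `|b t| <= s) ->
  (\int[mu]_t (expR (- b t))%:E
     <= (expR (s ^+ 2 / 2 - fine (\int[mu]_t (b t)%:E)))%:E)%E.
Proof.
move=> s0 mb bs; have ib := integrable_ae_bounded mb bs.
have m_le := ae_bounded_integral mb bs.
set m := fine _ in m_le *.
have bE : (\int[mu]_t (b t)%:E = m%:E)%E.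
  by rewrite /m fineK//; exact: integrable_fin_num.
pose ch := (expR s + expR (- s)) / 2; pose sh := (expR s - expR (- s)) / 2.
(* [ch] and [sh] are cosh s and sinh s, the coefficients of the chord. *)
apply: (@le_trans _ _ (\int[mu]_t (ch%:E - (sh / s)%:E * (b t)%:E))%E).
  apply: ae_le_integral.
  - apply/measurable_EFinP; apply: measurableT_comp => //.
    exact: measurable_funN.
  - apply: emeasurable_funB => //; apply: emeasurable_funM => //.
    exact/measurable_EFinP.
  - apply: filterS bs => t bt; rewrite -EFinM -EFinB lee_fin.
    by apply: (le_trans (expR_chord bt)); rewrite -/ch -/sh; lra.
have ich : mu.-integrable [set: T] (cst ch%:E) by exact: finite_measure_integrable_cst.
rewrite integralB//; last exact: integrableZl.
rewrite integralZl// bE integral_cst_probability -EFinM -EFinB.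
rewrite lee_fin.
have [s_eq0|s_neq0] := eqVneq s 0.
  move: m_le; rewrite s_eq0 normr_le0 => /eqP ->.
  by rewrite /ch s_eq0 oppr0 expR0 mulr0 expr0n /= mul0r addr0 expR0; lra.
have s_gt0 : 0 < s by rewrite lt_neqAle eq_sym s_neq0.
(* The slope m / s is in [-1, 1] because the mean inherits the bound on [b]. *)
have := @hoeffding_cosh_sinh R (m / s) s.
rewrite ler_pdivlMr// ler_pdivrMr// mulN1r mul1r -ler_norml => /(_ m_le s0).
by rewrite -/ch -/sh divfK// (_ : m / s * sh = sh / s * m)//; field.
Qed.

Lemma integral_gt0 d (T : measurableType d) (R : realType)
    (mu : probability T R) (f : T -> R) :
  measurable_fun [set: T] f -> (forall t, 0 < f t) ->
  (0 < \int[mu]_t (f t)%:E)%E.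
Proof.
move=> mf f0; rewrite lt_neqAle integral_ge0 ?andbT; last first.
  by move=> t _; rewrite lee_fin ltW.
apply/eqP => /esym int0.
have mEf : measurable_fun [set: T] (EFin \o f) by exact/measurable_EFinP.
have /(ae_eq_integral_abs mu measurableT mEf) : (\int[mu]_t `|(f t)%:E| = 0)%E.
  by rewrite -[RHS]int0; apply: eq_integral => t _; rewrite gee0_abs// lee_fin ltW.
move=> [N [mN N0 sub]]; suff : mu [set: T] = 0%E.
  by rewrite probability_setT => /eqP; rewrite onee_eq0.
apply/eqP; rewrite eq_le measure_ge0 andbT -N0 le_measure ?inE//.
move=> t _; apply: sub => /= /(_ I) /eqP; rewrite eqe => /eqP ft0.
by have := f0 t; rewrite ft0 ltxx.
Qed.

(** Half of the Donsker-Varadhan principle: with h the density of [mu], integrate ln (g / h) <= g /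
    h - 1 under [mu]; the right-hand side integrates to at most 0. *)
Lemma KL_ge_integral_ln d (T : measurableType d) (R : realType)
    (mu nu : probability T R) (g : T -> R) : mu `<< nu ->
  measurable_fun [set: T] g -> (forall t, 0 < g t) ->
  (\int[nu]_t (g t)%:E <= 1)%E ->
  mu.-integrable [set: T] (fun t => (ln (g t))%:E) ->
  (\int[mu]_t (ln (g t))%:E <= KL mu nu)%E.
Proof.
move=> munu mg g0 g1 ig; rewrite /KL.
set h := Radon_Nikodym _ _.
have hfin t : h t \is a fin_num by exact: Radon_Nikodym_fin_num.
have ih : nu.-integrable [set: T] h by exact: Radon_Nikodym_integrable.
have hE A : measurable A -> mu A = (\int[nu]_(t in A) h t)%E.
  by move=> mA; rewrite -Radon_Nikodym_integral.
have mh : measurable_fun [set: T] h by exact: measurable_int ih.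
pose hr t := fine (h t).
have mhr : measurable_fun [set: T] hr by exact: measurableT_comp.
have hrE t : h t = (hr t)%:E by rewrite /hr fineK.
(* The derivative is positive only [mu]-almost everywhere; the bad set is [mu]-null, since its
   measure is the integral over it of a nonpositive function. *)
pose N := [set t | hr t <= 0].
have mN : measurable N.
  have := mhr measurableT `]-oo, 0]%classic (measurable_itv _).
  by rewrite setTI; congr measurable; apply/seteqP; split=> t /=; rewrite in_itv.
have muN : mu N = 0%E.
  apply/eqP; rewrite eq_le measure_ge0 andbT hE//.
  rewrite -oppe_ge0 -integralN; last first.
    apply: integrable_add_def => //.
    exact: integrableS ih.
  apply: integral_ge0 => t Nt; rewrite oppe_ge0 hrE lee_fin; exact: Nt.
have aeN : \forall t \ae mu, 0 < hr t.
  exists N; split=> // t /= /negP; rewrite -leNgt; exact.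
(* An everywhere nonnegative version of the density, as [ge0_integral_density] requires. *)
pose q t := Num.max 0 (hr t).
have q0 t : 0 <= q t by rewrite /q le_max lexx.
have mq : measurable_fun [set: T] q by exact: measurable_maxr.
have qE A : measurable A -> mu A = (\int[nu]_(t in A) (q t)%:E)%E.
  move=> mA; have AN : measurable (A `\` N) by exact: measurableD.
  transitivity (mu (A `\` N)).
    have muAN : mu (A `&` N) = 0%E.
      apply/eqP; rewrite eq_le measure_ge0 andbT -muN le_measure ?inE//.
      exact: measurableI.
    apply/esym; rewrite measureD//; last by rewrite ltey_eq fin_num_measure.
    by rewrite [X in (_ - X)%E]muAN sube0.
  rewrite hE// integral_mkcond [RHS]integral_mkcond; apply: eq_integral => t _.
  rewrite /patch; case: ifPn; rewrite in_setD.
    move=> /andP[-> /negP Nt]; rewrite hrE /q max_r// ltW// ltNge.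
    by apply/negP => h0; apply: Nt; rewrite inE.
  rewrite negb_and negbK => /orP[/negPf -> //|]; rewrite inE => Nt.
  by case: ifP => // _; rewrite /q max_l.
pose r t := g t / q t.
have mr : measurable_fun [set: T] r.
  apply: measurable_funM => //; apply: (measurableT_comp (@measurable_invr R)).
  exact: mq.
have r0 t : 0 <= r t by rewrite divr_ge0// ltW.
(* Only an inequality: the mass of [g] where [q] vanishes is lost. *)
have rle1 : (\int[mu]_t (r t)%:E <= 1)%E.
  rewrite (@ge0_integral_density _ _ _ nu q)//; last exact/measurable_EFinP.
  apply: le_trans g1; apply: le_integral_pointwise => t; rewrite -EFinM lee_fin.
  rewrite /r; have [->|qt0] := eqVneq (q t) 0; first by rewrite mulr0 ltW.
  by rewrite divfK.
have ir : mu.-integrable [set: T] (EFin \o r).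
  apply/integrableP; split; first exact/measurable_EFinP.
  under eq_integral do rewrite gee0_abs ?lee_fin//.
  by rewrite (le_lt_trans rle1)// ltry.
have i1 : mu.-integrable [set: T] (cst 1%E) by exact: finite_measure_integrable_cst.
have i1r : mu.-integrable [set: T] (fun t => 1 - (r t)%:E)%E.
  exact: (integrableB measurableT i1 ir).
(* The added integral of 1 - r is nonnegative; what remains is ln g + 1 - g / h <= ln h almost
   everywhere. *)
apply: (@le_trans _ _ (\int[mu]_t ((ln (g t))%:E + (1 - (r t)%:E)))%E).
  rewrite integralD//= leeDl// (integralB measurableT i1 ir).
  rewrite integral_cst_probability.
  by rewrite sube_ge0 ?rle1// orbC.
apply: ae_le_integral.
- apply: emeasurable_funD; first exact: measurable_int ig.
  by apply: emeasurable_funB => //; exact/measurable_EFinP.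
- rewrite (_ : (fun _ => _) = fun t => if hr t <= 0 then -oo%E else (ln (hr t))%:E).
    apply: measurable_fun_ifT => //.
      exact: measurable_fun_ler.
    by apply/measurable_EFinP; apply: measurableT_comp => //; exact: measurable_ln.
  by apply/funext => t; rewrite hrE.
- apply: filterS aeN => t hr0; rewrite hrE lne_EFin// -EFinB -EFinD lee_fin.
  have qt : q t = hr t by rewrite /q max_r// ltW.
  have := ln_le_subr1 (divr_gt0 (g0 t) hr0).
  by rewrite ln_div ?posrE// /r qt; lra.
Qed.

(** * Mixtures [mu k] and the constant [Balpha] *)

Lemma null_dominates_ae d (T : measurableType d) (R : realType)
    (mu nu : {measure set T -> \bar R}) (P : T -> Prop) :
  mu `<< nu -> (\forall t \ae nu, P t) -> (\forall t \ae mu, P t).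
Proof.
by move=> /null_content_dominatesP dom [A [mA A0 sub]]; exists A; split=> //;
  exact: dom.
Qed.

Section mixture.
Context (R : realType) (dT dY : measure_display).
Context (T : measurableType dT) (Y : measurableType dY).
Context (nu : {sigma_finite_measure set Y -> \bar R}).
Context (k : {mfun (T * Y)%type >-> R}).
Context (k_gt0 : forall t y, 0 < k (t, y)).
Context (k_int : forall t, (\int[nu]_y (k (t, y))%:E = 1)%E).
Implicit Types mu : probability T R.

Lemma measurable_EFink : measurable_fun [set: T * Y] (fun z => (k z)%:E).
Proof. exact/measurable_EFinP/measurable_funP. Qed.

Lemma measurable_k1 y : measurable_fun [set: T] (fun t => k (t, y)).
Proof. exact: (measurableT_comp (measurable_funPT k) (pair2_measurable _)). Qed.

Lemma k_ge0 z : (0 <= (k z)%:E)%E.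
Proof. by case: z => t y; rewrite lee_fin ltW. Qed.

Lemma measurable_mixke mu :
  measurable_fun [set: Y] (fun y => \int[mu]_t (k (t, y))%:E)%E.
Proof.
exact: (measurable_fun_fubini_tonelli_G (fun z => (k z)%:E) measurable_EFink k_ge0).
Qed.

Lemma mixke_ge0 (mu : {measure set T -> \bar R}) y : (0 <= \int[mu]_t (k (t, y))%:E)%E.
Proof. by apply: integral_ge0 => t _; exact: k_ge0. Qed.

Lemma mixke_gt0 mu y : (0 < \int[mu]_t (k (t, y))%:E)%E.
Proof. by apply: integral_gt0 => //; exact: measurable_k1. Qed.

Lemma integral_mixke mu :
  (\int[nu]_y (\int[mu]_t (k (t, y))%:E) = 1)%E.
Proof.
rewrite -(@fubini_tonelli _ _ _ _ _ mu nu (fun z => (k z)%:E))//=; last 2 first.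
- exact: measurable_EFink.
- exact: k_ge0.
under eq_integral do rewrite k_int.
exact: integral_cst_probability.
Qed.

(** By Tonelli the extended-real mixture has [nu]-integral 1, hence is finite almost everywhere, and
    [fine] alters it only on a null set. *)
Lemma ae_mixk mu :
  \forall y \ae nu, (mixk k mu y)%:E = (\int[mu]_t (k (t, y))%:E)%E.
Proof.
have /integrable_ae : nu.-integrable [set: Y] (fun y => \int[mu]_t (k (t, y))%:E)%E.
  apply/integrableP; split; first exact: measurable_mixke.
  under eq_integral do rewrite gee0_abs ?mixke_ge0//.
  by rewrite integral_mixke ltry.
by move=> /(_ measurableT); apply: filterS => y /(_ I) yfin; rewrite /mixk fineK.
Qed.

Lemma mixk_ge0 (mu : {measure set T -> \bar R}) y : 0 <= mixk k mu y.
Proof. by rewrite /mixk fine_ge0// mixke_ge0. Qed.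

Lemma ae_mixk_gt0 mu : \forall y \ae nu, 0 < mixk k mu y.
Proof.
apply: filterS (ae_mixk mu) => y.
by have := mixke_gt0 mu y => + yE; rewrite -yE lte_fin.
Qed.

Lemma measurable_mixk mu : measurable_fun [set: Y] (mixk k mu).
Proof. by apply: measurableT_comp => //; exact: measurable_mixke. Qed.

Lemma integral_mixk mu : (\int[nu]_y (mixk k mu y)%:E = 1)%E.
Proof.
rewrite -(integral_mixke mu); apply: ae_eq_integral => //.
- exact/measurable_EFinP/measurable_mixk.
- exact: measurable_mixke.
- by apply: filterS (ae_mixk mu) => y ->.
Qed.

Context (mu1 : probability T R).

(* The supremum over [t] need not be measurable in [y]; the essential supremum
   is, and it suffices since every [muhat] and [mustar] is dominated by [mu1]. *)
Definition esssupk (y : Y) : \bar R := ess_sup mu1 (fun t => (k (t, y))%:E).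

Lemma measurable_esssupk : measurable_fun [set: Y] esssupk.
Proof. exact/measurable_ess_sup_curry/measurable_funP. Qed.

Lemma esssupk_ge0 y : (0 <= esssupk y)%E.
Proof.
apply: ess_sup_gee; first by rewrite [ltRHS](probability_setT mu1) lte01.
by apply: aeW => t; exact: k_ge0.
Qed.

Lemma ae_esssupk y : \forall t \ae mu1, ((k (t, y))%:E <= esssupk y)%E.
Proof. exact: ess_sup_ge. Qed.

Lemma mixk_le_esssupk mu y : mu `<< mu1 -> ((mixk k mu y)%:E <= esssupk y)%E.
Proof.
move=> dom; rewrite /mixk; set I := (X in fine X).
have [Ifin|] := boolP (I \is a fin_num); last first.
  (* An infinite mixture is sent to 0 by [fine], below any essential supremum. *)
  by rewrite fin_numE negb_and !negbK => /orP[]/eqP ->; exact: esssupk_ge0.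
rewrite fineK// /I -[leRHS](integral_cst_probability mu).
apply: ae_le_integral => //.
- exact/measurable_EFinP/measurable_k1.
- exact: (null_dominates_ae dom (ae_esssupk y)).
Qed.

Context (p : {mfun Y >-> R}) (alpha : R).
Context (p_gt0 : forall y, 0 < p y).

(* [k (t, y) * score y (mu k y)] is the summand of [bhat]. *)
Definition score (y : Y) (q : R) : R := dfalpha alpha (q / p y) / q.

Lemma measurable_score d (X : measurableType d) (f : X -> Y) (q : X -> R) :
  measurable_fun [set: X] f -> measurable_fun [set: X] q ->
  measurable_fun [set: X] (fun x => score (f x) (q x)).
Proof.
move=> mf mq; apply: measurable_funM; last exact: measurableT_comp (@measurable_invr R) mq.
apply: (measurableT_comp (measurable_dfalpha alpha)).
apply: measurable_funM => //; apply: (measurableT_comp (@measurable_invr R)).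
exact: measurableT_comp.
Qed.

Lemma scoreE y q x : 0 <= q ->
  x / q * derive1 (falpha alpha) (q / p y) = x * score y q.
Proof.
(* At q = 0 both sides vanish by the convention on the inverse of 0, so the identity holds for every
   y and not just almost every y. *)
rewrite le_eqVlt => /predU1P[<-|q0]; first by rewrite /score invr0 !(mulr0, mul0r).
by rewrite derive1_falpha ?divr_gt0// mulrAC -mulrA.
Qed.

Lemma bhatE (M : nat) mu (ys : 'I_M -> Y) t :
  bhat k p alpha mu ys t =
  M%:R^-1 * \sum_(m < M) k (t, ys m) * score (ys m) (mixk k mu (ys m)).
Proof.
by congr (_ * _); apply: eq_bigr => m _; rewrite scoreE// mixk_ge0.
Qed.

(** The [mu1]-essential bound on one summand of [bhat]; extended-valued because [esssupk] may be
    infinite, yet 0 when the score vanishes. *)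
Definition score_sup (y : Y) (q : R) : \bar R := (esssupk y * `|score y q|%:E)%E.

Lemma score_sup_ge0 y q : (0 <= score_sup y q)%E.
Proof. by rewrite mule_ge0 ?esssupk_ge0// lee_fin. Qed.

Lemma measurable_score_sup d (X : measurableType d) (f : X -> Y) (q : X -> R) :
  measurable_fun [set: X] f -> measurable_fun [set: X] q ->
  measurable_fun [set: X] (fun x => score_sup (f x) (q x)).
Proof.
move=> mf mq; apply: emeasurable_funM.
  exact: measurableT_comp measurable_esssupk mf.
by apply/measurable_EFinP; apply: measurableT_comp => //; exact: measurable_score.
Qed.

Lemma ae_bhat_le y q :
  \forall t \ae mu1, ((k (t, y) * `|score y q|)%:E <= score_sup y q)%E.
Proof.
by apply: filterS (ae_esssupk y) => t kt; rewrite EFinM lee_wpmul2r// lee_fin.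
Qed.

(** With q and q' the values at y of mu k and mu' k, this is one summand of [bhat] integrated
    against mu - mu'. *)
Definition regret_incr (y : Y) (q q' : R) : R := score y q * (q - q').

(** Both mixtures lie between 0 and [esssupk], so their difference costs one [esssupk], not two. *)
Lemma regret_incr_le y mu mu' : mu `<< mu1 -> mu' `<< mu1 ->
  (`|regret_incr y (mixk k mu y) (mixk k mu' y)|%:E
     <= score_sup y (mixk k mu y))%E.
Proof.
move=> mu_dom mu'_dom; rewrite /regret_incr normrM mulrC EFinM lee_wpmul2r ?lee_fin//.
have := mixk_le_esssupk y mu_dom; have := mixk_le_esssupk y mu'_dom.
have := mixk_ge0 mu y; have := mixk_ge0 mu' y.
move: (mixk k mu y) (mixk k mu' y) => a b b0 a0.
case: (esssupk y) => [s| |]; rewrite ?leey ?leeNy_eq// !lee_fin => bs as_.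
by rewrite ler_norml; apply/andP; split; lra.
Qed.

Definition Bsq : \bar R := ereal_sup (range (fun mu : probability T R =>
    \int[nu]_y ereal_sup [set
      (k (t, y) ^+ 2 / k (t', y)
        * `|derive1 (falpha alpha) (mixk k mu y / p y)| ^+ 2)%:E
      | t in [set: T] & t' in [set: T]]))%E.

Lemma score_sup_sq_le mu y :
  (score_sup y (mixk k mu y) ^+ 2 * (mixk k mu y)%:E <=
    ereal_sup [set
      (k (t, y) ^+ 2 / k (t', y)
        * `|derive1 (falpha alpha) (mixk k mu y / p y)| ^+ 2)%:E
      | t in [set: T] & t' in [set: T]])%E.
Proof.
set G := ereal_sup _; set q := mixk k mu y.
have t0 : T by have := @point T; exact.
have Gub t t' : ((k (t, y) ^+ 2 / k (t', y)
     * `|derive1 (falpha alpha) (q / p y)| ^+ 2)%:E <= G)%E.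
  by apply: ereal_sup_ubound; exists t => //; exists t'.
have G0 : (0 <= G)%E.
  apply: le_trans (Gub t0 t0); rewrite lee_fin.
  by rewrite mulr_ge0 ?sqr_ge0// divr_ge0 ?sqr_ge0// ltW.
(* The mixture is positive as an extended real, so q = 0 signals an infinite integral; the weight
   then annihilates the left-hand side. *)
have := mixk_ge0 mu y; rewrite -/q le_eqVlt => /predU1P[<-|q0].
  by rewrite mule0.
rewrite derive1_falpha ?divr_gt0// in Gub.
have [sc0|sc0] := eqVneq (score y q) 0.
  by rewrite /score_sup sc0 normr0 mule0 expe2 mule0 mul0e.
case: G G0 Gub => [g| |]; rewrite ?leey ?leeNy_eq// lee_fin => g0 Gub.
pose c := `|score y q|.
have c0 : 0 < c by rewrite normr_gt0.
(* Chosen so that (r c)^2 q = g: it suffices to bound every k(t,y) by [r]. *)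
pose r := Num.sqrt (g / q) / c.
have r0 : 0 <= r by rewrite divr_ge0 ?sqrtr_ge0// ltW.
have qE : (\int[mu]_t (k (t, y))%:E = q%:E)%E.
  rewrite /q /mixk fineK// ge0_fin_numE ?mixke_ge0//.
  rewrite ltNge leye_eq; apply/negP => /eqP qoo.
  by move: q0; rewrite /q /mixk qoo ltxx.
have dfE : dfalpha alpha (q / p y) = score y q * q.
  by rewrite /score divfK// gt_eqF.
have kr t : k (t, y) <= r.
  (* Integrate [k (t, y) ^ 2 * df ^ 2 <= g * k (t', y)] over [t'] under [mu]. *)
  have : (((k (t, y) * c * q) ^+ 2)%:E <= g%:E * q%:E)%E.
    rewrite -qE -ge0_integralZl//; last 2 first.
    - exact/measurable_EFinP/measurable_k1.
    - by move=> t' _; exact: k_ge0.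
    rewrite -[leLHS](integral_cst_probability mu).
    apply: le_integral_pointwise => t' /=.
    have := Gub t t'; rewrite -EFinM !lee_fin => H.
    have := ler_wpM2r (ltW (k_gt0 t' y)) H; rewrite dfE normrM (gtr0_norm q0) -/c.
    apply: le_trans; rewrite le_eqVlt; apply/orP; left; apply/eqP.
    by field; rewrite gt_eqF.
  rewrite -EFinM lee_fin => H.
  rewrite /r ler_pdivlMr// -(@ger0_norm _ (k (t, y) * c)); last first.
    by rewrite mulr_ge0// ltW.
  rewrite -sqrtr_sqr ler_wsqrtr// ler_pdivlMr//.
  rewrite -(ler_pM2r q0); apply: le_trans H.
  by rewrite le_eqVlt; apply/orP; left; apply/eqP; ring.
have Sr : (esssupk y <= r%:E)%E.
  by apply/ess_supP; apply: aeW => t; rewrite lee_fin.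
have : (score_sup y q <= (r * c)%:E)%E.
  by rewrite /score_sup EFinM lee_wpmul2r// lee_fin.
have := score_sup_ge0 y q; case: (score_sup y q) => [s| |]//.
rewrite lee_fin => s0; rewrite lee_fin => src.
rewrite -EFin_expe -EFinM lee_fin.
have {}src : s <= Num.sqrt (g / q) by rewrite (le_trans src)// /r divfK// gt_eqF.
rewrite -ler_pdivlMr// -(sqr_sqrtr (a := g / q)); last by rewrite divr_ge0// ltW.
by rewrite ler_pXn2r// nnegrE sqrtr_ge0.
Qed.

Lemma integral_score_sup_sq mu :
  (\int[nu]_y (score_sup y (mixk k mu y) ^+ 2 * (mixk k mu y)%:E) <= Bsq)%E.
Proof.
apply: (le_trans (le_integral_pointwise _ (score_sup_sq_le mu))).
by apply: ereal_sup_ubound; exists mu.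
Qed.

End mixture.

(** Turns the second-moment bound by [Bsq] into a finite first moment. *)
Lemma lee_sqr1 (R : realType) (x : \bar R) : (0 <= x -> x <= x ^+ 2 + 1)%E.
Proof.
case: x => [r| |]; last 2 first.
- by rewrite expe2 mulyy addye// leey.
- by rewrite leeNy_eq.
by rewrite lee_fin => r0; rewrite -EFin_expe -EFinD lee_fin; nra.
Qed.

(** * Linearization of the gap of [Psi] *)

Section gap.
Context (R : realType) (dT dY : measure_display).
Context (T : measurableType dT) (Y : measurableType dY).
Context (nu : {sigma_finite_measure set Y -> \bar R}).
Context (k : {mfun (T * Y)%type >-> R}).
Context (k_gt0 : forall t y, 0 < k (t, y)).
Context (k_int : forall t, (\int[nu]_y (k (t, y))%:E = 1)%E).
Context (p : {mfun Y >-> R}) (alpha : R).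
Context (p_gt0 : forall y, 0 < p y).
Context (mu1 : probability T R).
Context (B_fin : (Bsq nu k p alpha < +oo)%E).

Let incr (mu mu' : probability T R) y : R :=
  regret_incr p alpha y (mixk k mu y) (mixk k mu' y) * mixk k mu y.

(** Formally the integral of [balpha] at mu against mu - mu', with the two integrations exchanged.
    In this form it is the mean of [regret_incr] when y has density mu k. *)
Definition lin_gap (mu mu' : probability T R) : \bar R :=
  (\int[nu]_y (incr mu mu' y)%:E)%E.

Lemma integral_score_sup_mixk (mu : probability T R) :
  (\int[nu]_y (score_sup k mu1 p alpha y (mixk k mu y) * (mixk k mu y)%:E)
     <= Bsq nu k p alpha + 1)%E.
Proof.
set C := fun y => score_sup k mu1 p alpha y (mixk k mu y).
have mq : measurable_fun [set: Y] (fun y => (mixk k mu y)%:E).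
  exact/measurable_EFinP/measurable_mixk.
have mC2 : measurable_fun [set: Y] (fun y => C y ^+ 2 * (mixk k mu y)%:E)%E.
  apply: emeasurable_funM => //; under eq_fun do rewrite expe2.
  by apply: emeasurable_funM; apply: measurable_score_sup => //; exact: measurable_mixk.
have q0 y : (0 <= (mixk k mu y)%:E)%E by rewrite lee_fin mixk_ge0.
have C0 y : (0 <= C y)%E by exact: score_sup_ge0.
(* The second summand has integral 1, which is the source of the [+ 1]. *)
apply: (@le_trans _ _ (\int[nu]_y (C y ^+ 2 * (mixk k mu y)%:E + (mixk k mu y)%:E))%E).
  apply: le_integral_pointwise => y.
  rewrite -[X in (_ + X)%E]mul1e -ge0_muleDl ?sqre_ge0//.
  by apply: lee_wpmul2r => //; exact: (lee_sqr1 (C0 y)).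
rewrite ge0_integralD//; last by move=> y _; rewrite mule_ge0 ?sqre_ge0.
by rewrite (integral_mixk k_gt0 k_int) leeD2r// integral_score_sup_sq.
Qed.

Lemma incr_le (mu mu' : probability T R) y : mu `<< mu1 -> mu' `<< mu1 ->
  (`|(incr mu mu' y)%:E| <=
    score_sup k mu1 p alpha y (mixk k mu y) * (mixk k mu y)%:E)%E.
Proof.
move=> dom dom'; rewrite /incr abse_EFin normrM EFinM (ger0_norm (mixk_ge0 _ _ _))//.
rewrite lee_wpmul2r ?lee_fin ?mixk_ge0//.
exact: (regret_incr_le k_gt0).
Qed.

Lemma measurable_incr (mu mu' : probability T R) : measurable_fun [set: Y] (incr mu mu').
Proof.
have mm (m : probability T R) : measurable_fun [set: Y] (mixk k m).
  exact: measurable_mixk.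
by do 2 apply: measurable_funM => //; [exact: measurable_score|exact: measurable_funB].
Qed.

Lemma integrable_incr (mu mu' : probability T R) : mu `<< mu1 -> mu' `<< mu1 ->
  nu.-integrable [set: Y] (EFin \o incr mu mu').
Proof.
move=> dom dom'; apply/integrableP; split; first exact/measurable_EFinP/measurable_incr.
apply: (@le_lt_trans _ _ (Bsq nu k p alpha + 1)%E).
  apply: le_trans (integral_score_sup_mixk mu).
  by apply: le_integral_pointwise => y; exact: incr_le.
by rewrite lte_add_pinfty// ltry.
Qed.

Lemma mixk_mscale_sum (mus : nat -> probability T R) (a : nat -> {nonneg R}) N y :
  mixk k (msum (fun i => mscale (a i) (mus i)) N) y =
  fine (\sum_(i < N) (a i)%:num%:E * \int[mus i]_t (k (t, y))%:E)%E.
Proof.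
rewrite /mixk ge0_integral_measure_sum//; last 2 first.
- by move=> t _; exact: k_ge0.
- exact/measurable_EFinP/measurable_k1.
congr fine; apply: eq_bigr => i _; rewrite ge0_integral_mscale//.
- exact/measurable_EFinP/measurable_k1.
- by move=> t _; exact: k_ge0.
Qed.

Lemma falpha_jensen (N : nat) (a u : 'I_N -> R) :
  (forall i, 0 <= a i) -> \sum_i a i = 1 -> (forall i, 0 < u i) ->
  falpha alpha (\sum_i a i * u i) <= \sum_i a i * falpha alpha (u i).
Proof.
move=> a0 a1 u0; set v := \sum_i _.
have v0 : 0 < v.
  rewrite lt_neqAle sumr_ge0 ?andbT; last by move=> i _; rewrite mulr_ge0// ltW.
  apply/eqP => /esym/eqP; rewrite psumr_eq0; last by move=> i _; rewrite mulr_ge0// ltW.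
  move=> /allP a00; move: a1; rewrite big1; first by move/esym/eqP; rewrite oner_eq0.
  move=> i _; have := a00 i (mem_index_enum _); rewrite mulf_eq0 => /orP[/eqP//|].
  by rewrite gt_eqF.
have : \sum_i a i * (falpha alpha v + dfalpha alpha v * (u i - v)) <=
    \sum_i a i * falpha alpha (u i).
  by apply: ler_sum => i _; rewrite ler_wpM2l// falpha_tangent_le.
apply: le_trans.
rewrite (eq_bigr (fun i => a i * falpha alpha v + dfalpha alpha v * (a i * u i - a i * v))).
  rewrite big_split /= -mulr_suml a1 mul1r -mulr_sumr big_split /= sumrN -mulr_suml.
  by rewrite a1 mul1r subrr mulr0 addr0.
by move=> i _; ring.
Qed.

(** Convexity enters twice: Jensen passes from the average to each [mus i], then the tangent at
    [mus i], not at [mustar], gives the linear term that sampling from [mus i] can estimate. *)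
Lemma Psi_gap_le (mus : nat -> probability T R) (mustar : probability T R)
    (a : nat -> {nonneg R}) N :
  (forall i, mus i `<< mu1) -> mustar `<< mu1 ->
  \sum_(i < N) (a i)%:num = 1 ->
  (Psi nu k p alpha (msum (fun i => mscale (a i) (mus i)) N)
     - Psi nu k p alpha mustar
   <= \sum_(i < N) (a i)%:num%:E * lin_gap (mus i) mustar)%E.
Proof.
move=> dom doms a1.
pose F q (y : Y) : R := falpha alpha (q / p y) * p y.
have mF (q : Y -> R) : measurable_fun [set: Y] q ->
    measurable_fun [set: Y] (fun y => F (q y) y).
  move=> mq; apply: measurable_funM => //.
  apply: (measurableT_comp (measurable_falpha alpha)).
  by apply: measurable_funM => //; exact: measurableT_comp (@measurable_invr R) _.
have F0 q y : 0 < q -> 0 <= F q y.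
  by move=> q0; rewrite /F mulr_ge0 ?falpha_ge0 ?divr_gt0// ltW.
have ms : measurable_fun [set: Y] (fun y => F (mixk k mustar y) y).
  by apply: mF; exact: measurable_mixk.
(* An infinite value makes the left-hand side -oo; a finite one can be moved across the
   inequality. *)
have [Psioo|Psifin] := eqVneq (Psi nu k p alpha mustar) +oo%E.
  by rewrite Psioo addeNy leNye.
have istar : nu.-integrable [set: Y] (fun y => (F (mixk k mustar y) y)%:E).
  apply/integrableP; split; first exact/measurable_EFinP.
  rewrite (_ : \int[nu]_y _ = Psi nu k p alpha mustar)%E ?ltey//.
  apply: ae_eq_integral => //.
  - by apply: measurableT_comp => //; exact/measurable_EFinP.
  - exact/measurable_EFinP.
  - apply: filterS (ae_mixk_gt0 k_gt0 k_int mustar) => y qy _.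
    by rewrite abse_EFin ger0_norm// F0.
have fins : Psi nu k p alpha mustar \is a fin_num by exact: integrable_fin_num istar.
have ii i : nu.-integrable [set: Y] (fun y => (a i)%:num%:E * (incr (mus i) mustar y)%:E)%E.
  by apply: integrableZl => //; exact: integrable_incr.
have isum : nu.-integrable [set: Y]
    (fun y => \sum_(i < N) (a i)%:num%:E * (incr (mus i) mustar y)%:E)%E.
  by apply: integrable_sum => // i _.
rewrite leeBlDl//.
rewrite (_ : (\sum_(i < N) _)%E =
    (\int[nu]_y \sum_(i < N) (a i)%:num%:E * (incr (mus i) mustar y)%:E)%E); last first.
  rewrite integral_sum//; apply: eq_bigr => i _.
  by rewrite integralZl//; exact: integrable_incr.
rewrite /Psi -integralD//.
apply: ae_le_integral.
- apply/measurable_EFinP.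
  apply: (mF (mixk k (msum (fun i => mscale (a i) (mus i)) N))).
  rewrite (_ : mixk _ _ = fun y =>
    fine (\sum_(i < N) (a i)%:num%:E * \int[mus i]_t (k (t, y))%:E)%E); last first.
    by apply/funext => y; exact: mixk_mscale_sum.
  apply: measurableT_comp => //; apply: emeasurable_sum => i.
  by apply: emeasurable_funM => //; exact: measurable_mixke.
- by apply: emeasurable_funD; [exact/measurable_EFinP|exact: measurable_int isum].
- have aeq : \forall y \ae nu, forall i, 0 < mixk k (mus i) y.
    by apply: ae_foralln => i; exact: ae_mixk_gt0.
  have aeE : \forall y \ae nu, forall i,
      ((mixk k (mus i) y)%:E = \int[mus i]_t (k (t, y))%:E)%E.
    by apply: ae_foralln => i; exact: ae_mixk.
  apply: filterS3 aeq aeE (ae_mixk_gt0 k_gt0 k_int mustar) => y q0 qE qs0.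
  rewrite mixk_mscale_sum; under eq_bigr do rewrite -qE -EFinM.
  rewrite sumEFin /=; under [in leRHS]eq_bigr do rewrite -EFinM.
  rewrite sumEFin -EFinD lee_fin.
  have p0 := p_gt0 y.
  have key i : F (mixk k (mus i) y) y <= F (mixk k mustar y) y + incr (mus i) mustar y.
    have := falpha_tangent_le alpha (divr_gt0 qs0 p0) (divr_gt0 (q0 i) p0).
    rewrite -(ler_pM2r p0) /F /incr /regret_incr /score => H.
    have -> : dfalpha alpha (mixk k (mus i) y / p y) / mixk k (mus i) y *
        (mixk k (mus i) y - mixk k mustar y) * mixk k (mus i) y =
        - (dfalpha alpha (mixk k (mus i) y / p y) *
          (mixk k mustar y / p y - mixk k (mus i) y / p y) * p y).
      by field; rewrite !gt_eqF.
    by move: H; rewrite mulrDl; lra.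
  apply: (@le_trans _ _ (\sum_(i < N) (a i)%:num * F (mixk k (mus i) y) y)).
    rewrite mulr_suml; under eq_bigr do rewrite -mulrA.
    have := @falpha_jensen N (fun i => (a i)%:num) (fun i => mixk k (mus i) y / p y).
    move=> /(_ (fun i => ge0 (a i)) a1 (fun i => divr_gt0 (q0 i) p0)).
    rewrite -(ler_pM2r p0) => /le_trans; apply.
    by rewrite mulr_suml; under eq_bigr do rewrite -mulrA.
  rewrite -[X in _ <= X + _]mul1r -a1 mulr_suml -big_split /=.
  by apply: ler_sum => i _; rewrite -mulrDr ler_wpM2l.
Qed.

End gap.

(** * Regret of exponential weights *)

Lemma ge0_integral_density_in d (T : measurableType d) (R : realType)
    (mu m : {measure set T -> \bar R}) (q : T -> R) (f : T -> \bar R) (A : set T) :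
  measurable_fun [set: T] q -> (forall x, 0 <= q x) ->
  (forall A, measurable A -> m A = \int[mu]_(x in A) (q x)%:E)%E ->
  measurable A -> measurable_fun [set: T] f -> (forall x, 0 <= f x)%E ->
  (\int[m]_(x in A) f x = \int[mu]_(x in A) (f x * (q x)%:E))%E.
Proof.
move=> mq q0 mE mA mf f0; rewrite integral_mkcond [RHS]integral_mkcond.
rewrite (@ge0_integral_density _ _ _ mu q)//.
- by apply: eq_integral => x _; rewrite /patch; case: ifP => // _; rewrite mul0e.
- by apply/(measurable_restrictT f mA); exact: measurable_funTS.
- by move=> x; rewrite /patch; case: ifP.
Qed.

Section exponential_weights.
Context d (T : measurableType d) (R : realType).
Implicit Types (mu : probability T R) (b : {mfun T >-> R}).

Lemma measurable_expR_mul (eta : R) b :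
  measurable_fun [set: T] (fun t => expR (- eta * b t)).
Proof.
by apply: measurableT_comp => //; exact: measurable_funM.
Qed.

Lemma exp_weighted_gt0 mu eta b : (0 < exp_weighted mu eta b [set: T])%E.
Proof.
apply: integral_gt0 => [|t]; first exact: measurable_expR_mul.
exact: expR_gt0.
Qed.

Lemma exp_weighted_density (mu0 mu : probability T R) (g : T -> R) eta b A :
  measurable_fun [set: T] g -> (forall t, 0 <= g t) ->
  (forall A, measurable A -> mu A = \int[mu0]_(t in A) (g t)%:E)%E ->
  measurable A ->
  (exp_weighted mu eta b A
   = \int[mu0]_(t in A) (g t * expR (- eta * b t))%:E)%E.
Proof.
move=> mg g0 muE mA; rewrite /exp_weighted.
rewrite (@ge0_integral_density_in _ _ _ mu0 mu g)//.
  by apply: eq_integral => t _; rewrite -EFinM mulrC.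
exact/measurable_EFinP/measurable_expR_mul.
Qed.

Lemma mnormalize_density (mu0 mu : probability T R) (g : T -> R) eta b A :
  measurable_fun [set: T] g -> (forall t, 0 <= g t) ->
  (forall A, measurable A -> mu A = \int[mu0]_(t in A) (g t)%:E)%E ->
  measurable A -> (exp_weighted mu eta b [set: T] < +oo)%E ->
  (mnormalize (exp_weighted mu eta b) mu A
   = \int[mu0]_(t in A)
       (g t * expR (- eta * b t) / fine (exp_weighted mu eta b [set: T]))%:E)%E.
Proof.
move=> mg g0 muE mA zfin; rewrite /mnormalize.
have z0 := exp_weighted_gt0 mu eta b.
rewrite gt_eqF//= lt_eqF//= (exp_weighted_density eta b mg g0 muE mA).
under [RHS]eq_integral do rewrite EFinM.
rewrite ge0_integralZr//.
- apply/measurable_EFinP/measurable_funTS; apply: measurable_funM => //.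
  exact: measurable_expR_mul.
- by move=> t _; rewrite lee_fin mulr_ge0// expR_ge0.
- by rewrite lee_fin invr_ge0 fine_ge0// ltW.
Qed.

Section regret.
Context (mu : nat -> probability T R) (b : nat -> {mfun T >-> R}).
Context (eta s : nat -> R) (N : nat).
Context (muS : forall i, (i < N)%N ->
  mu i.+1 = mnormalize (exp_weighted (mu i) (eta i) (b i)) (mu i) :> (set T -> \bar R)).
Context (eta_ge0 : forall i, 0 <= eta i).
Context (s_ge0 : forall i, 0 <= s i).
Context (b_le : forall i, (i < N)%N -> \forall t \ae mu 0%N, `|b i t| <= s i).

Let z i := fine (exp_weighted (mu i) (eta i) (b i) [set: T]).

(** The recursion unrolled: its exponential is the density of [mu n] with respect to the initial
    measure. The logarithmic form gives positivity for free and is what gets integrated against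
    [mustar]. *)
Let logdens n t := \sum_(i < n) (- eta i * b i t - ln (z i)).

Let measurable_logdens n : measurable_fun [set: T] (logdens n).
Proof.
by apply: measurable_sum => i; apply: measurable_funB => //; exact: measurable_funM.
Qed.

Let measurable_dens n : measurable_fun [set: T] (fun t => expR (logdens n t)).
Proof. by apply: measurableT_comp => //; exact: measurable_logdens. Qed.

Let density_dominates n :
  (forall A, measurable A ->
     mu n A = \int[mu 0%N]_(t in A) (expR (logdens n t))%:E)%E -> mu n `<< mu 0%N.
Proof.
move=> muE; apply/null_content_dominatesP => A mA A0.
rewrite muE//; apply: null_set_integral => //.
  exact/measurable_EFinP/measurable_funTS/measurable_dens.
Qed.

(** Hoeffding gives both facts at once. Domination carries the bound on [b n], known under the
    initial measure, over to [mu n]. *)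
Let ln_z_le n : (n < N)%N -> mu n `<< mu 0%N ->
  (exp_weighted (mu n) (eta n) (b n) [set: T] < +oo)%E /\
  ln (z n) <= (eta n * s n) ^+ 2 / 2
              - eta n * fine (\int[mu n]_t (b n t)%:E)%E.
Proof.
move=> nN dom.
have bs := null_dominates_ae dom (b_le nN).
have ebs : \forall t \ae mu n, `|eta n * b n t| <= eta n * s n.
  by apply: filterS bs => t bt; rewrite normrM ger0_norm// ler_wpM2l.
have meb : measurable_fun [set: T] (fun t => eta n * b n t) by exact: measurable_funM.
have := hoeffding_mgf (mulr_ge0 (eta_ge0 n) (s_ge0 n)) meb ebs.
have -> : (\int[mu n]_t (eta n * b n t)%:E = (eta n)%:E * \int[mu n]_t (b n t)%:E)%E.
  under eq_integral do rewrite EFinM; rewrite integralZl//.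
  exact: integrable_ae_bounded bs.
have ib : (\int[mu n]_t (b n t)%:E)%E \is a fin_num.
  by apply: integrable_fin_num => //; exact: integrable_ae_bounded bs.
rewrite fineM//=.
have -> : (\int[mu n]_t (expR (- (eta n * b n t)))%:E)%E
    = exp_weighted (mu n) (eta n) (b n) [set: T].
  by apply: eq_integral => t _; rewrite mulNr.
move=> zle; have zfin := le_lt_trans zle (ltry _); split=> //.
have z0 := exp_weighted_gt0 (mu n) (eta n) (b n).
have zE : exp_weighted (mu n) (eta n) (b n) [set: T] = (z n)%:E.
  by rewrite /z fineK// ge0_fin_numE// ltW.
rewrite -ler_expR lnK; last by rewrite posrE -lte_fin -zE.
by rewrite -lee_fin -zE.
Qed.

(** Interleaved with [ln_z_le]: the density of step n yields domination, domination a finite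
    normalizer, and this the density of step n + 1. *)
Let muE n : (n <= N)%N -> forall A, measurable A ->
  (mu n A = \int[mu 0%N]_(t in A) (expR (logdens n t))%:E)%E.
Proof.
elim: n => [_ A mA|n IH nN A mA].
  under eq_integral do rewrite /logdens big_ord0 expR0.
  by rewrite integral_cst// mul1e.
have muE := IH (ltnW nN).
have dom := density_dominates muE; have [zfin _] := ln_z_le nN dom.
rewrite muS// (mnormalize_density (measurable_dens n) _ muE)//.
apply: eq_integral => t _; rewrite /logdens big_ord_recr /= -/(logdens n t).
congr EFin; rewrite addrA expRB expRD; congr (_ / _).
rewrite lnK// posrE -/(z n) fine_gt0// zfin andbT; exact: exp_weighted_gt0.
Qed.

Lemma regret_le (mustar : probability T R) : mustar `<< mu 0%N ->
  ((\sum_(i < N) eta i * (fine (\int[mu i]_t (b i t)%:E)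
                          - fine (\int[mustar]_t (b i t)%:E)))%R%:E
   <= KL mustar (mu 0%N) + (\sum_(i < N) (eta i * s i) ^+ 2 / 2)%:E)%E.
Proof.
move=> doms.
have bs (i : 'I_N) : \forall t \ae mustar, `|b i t| <= s i.
  by apply: null_dominates_ae (b_le (ltn_ord i)).
have ib (i : 'I_N) : mustar.-integrable [set: T] (EFin \o b i).
  exact: integrable_ae_bounded (bs i).
have iln (i : 'I_N) : mustar.-integrable [set: T]
    (fun t => (- eta i * b i t - ln (z i))%:E).
  under eq_fun do rewrite EFinB EFinM.
  apply: integrableB => //; first by apply: integrableZl => //; exact: ib.
  exact: finite_measure_integrable_cst.
have ilog : mustar.-integrable [set: T] (fun t => (ln (expR (logdens N t)))%:E).
  under eq_fun do rewrite expRK /logdens -sumEFin.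
  exact: integrable_sum.
have := KL_ge_integral_ln doms (measurable_dens N) (fun t => expR_gt0 _) _ ilog.
(* The total integral of the density is the mass of [mu N], namely 1. *)
rewrite -muE// (probability_setT (mu N)) lexx => /(_ isT).
have -> : (\int[mustar]_t (ln (expR (logdens N t)))%:E =
  (\sum_(i < N) (- eta i * fine (\int[mustar]_t (b i t)%:E)%E - ln (z i)))%R%:E)%E.
  under eq_integral do rewrite expRK /logdens -sumEFin.
  rewrite (@integral_sum _ _ _ mustar _ measurableT 'I_N
    (fun i t => (- eta i * b i t - ln (z i))%:E))// -sumEFin.
  apply: eq_bigr => i _.
  under eq_integral do rewrite EFinB EFinM.
  rewrite integralB//; last 2 first.
  - by apply: integrableZl => //; exact: ib.
  - exact: finite_measure_integrable_cst.
  rewrite integralZl//; last exact: ib.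
  rewrite integral_cst_probability EFinB EFinM fineK//.
  by apply: integrable_fin_num => //; exact: ib.
move=> KLle; rewrite -leeBlDr//; apply: le_trans KLle.
rewrite -EFinB lee_fin -sumrB; apply: ler_sum => i _.
have [_] := ln_z_le (ltn_ord i) (density_dominates (muE (ltnW (ltn_ord i)))).
by lra.
Qed.

End regret.
End exponential_weights.

(** The variational bound at the constant density 1. *)
Lemma KL_ge0 d (T : measurableType d) (R : realType) (mu nu : probability T R) :
  mu `<< nu -> (0 <= KL mu nu)%E.
Proof.
move=> dom.
have := @KL_ge_integral_ln _ T R mu nu (cst 1) dom (measurable_cst _) (fun=> ltr01).
rewrite [X in (X <= 1)%E](integral_cst_probability nu 1%E) lexx => /(_ isT).
rewrite (_ : (fun t : T => _) = cst 0%E); last by apply/funext => t; rewrite /= ln1.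
by rewrite integral_cst_probability; apply; exact: integrable0.
Qed.

(** Nonnegativity of the empirical variance; it reduces the second moment of an average of M draws
    to that of one draw. *)
Lemma sqr_mean_le (R : realFieldType) (M : nat) (x : 'I_M -> R) : (0 < M)%N ->
  (M%:R^-1 * \sum_m x m) ^+ 2 <= M%:R^-1 * \sum_m x m ^+ 2.
Proof.
move=> M0; have M0' : (0 : R) < M%:R by rewrite ltr0n.
set a := M%:R^-1 * \sum_m x m.
have : 0 <= M%:R^-1 * \sum_m (x m - a) ^+ 2.
  by rewrite mulr_ge0 ?invr_ge0 ?ler0n// sumr_ge0// => m _; rewrite sqr_ge0.
rewrite (eq_bigr (fun m => x m ^+ 2 + (a ^+ 2 - 2 * a * x m))); last first.
  by move=> m _; ring.
rewrite big_split /= sumrB sumr_const card_ord -mulr_sumr mulrDr.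
have -> : \sum_m x m = M%:R * a by rewrite /a mulrA mulfV ?mul1r// gt_eqF.
rewrite -mulr_natl => H; rewrite -subr_ge0; apply: le_trans H _.
by rewrite le_eqVlt; apply/orP; left; apply/eqP; field; rewrite gt_eqF.
Qed.

(** * Regret along one fixed sample path *)

Section path_regret.
Context (R : realType) (dT dY : measure_display).
Context (T : measurableType dT) (Y : measurableType dY).
Context (k : {mfun (T * Y)%type >-> R}).
Context (k_gt0 : forall t y, 0 < k (t, y)).
Context (p : {mfun Y >-> R}) (alpha : R).
Context (p_gt0 : forall y, 0 < p y).
Context (M : nat) (M_gt0 : (0 < M)%N).
Context (mus : nat -> probability T R) (mustar : probability T R).
Context (ys : nat -> 'I_M -> Y) (eta : nat -> R) (N : nat).
Context (eta_gt0 : forall i, 0 < eta i).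
Context (musS : forall i, (i < N)%N ->
  mus i.+1 = mnormalize (exp_weighted (mus i) (eta i)
    (bhat k p alpha (mus i) (ys i))) (mus i) :> (set T -> \bar R)).
Context (mustar_dom : mustar `<< mus 0%N).
Context (mus_dom : forall i, mus i `<< mus 0%N).

Let q i m := mixk k (mus i) (ys i m).
Let C i m := score_sup k (mus 0%N) p alpha (ys i m) (q i m).
Let sc i m := score p alpha (ys i m) (q i m).

Lemma integral_k_score (mu : probability T R) i m : mu `<< mus 0%N ->
  (C i m < +oo)%E ->
  mu.-integrable [set: T] (fun t => (k (t, ys i m) * sc i m)%:E) /\
  (\int[mu]_t (k (t, ys i m) * sc i m)%:E = (mixk k mu (ys i m) * sc i m)%:E)%E.
Proof.
move=> dom Cfin.
(* A finite product leaves two cases: either the score vanishes and the integrand with it, or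
   [esssupk] itself is finite. *)
have [sc0|sc0] := eqVneq (sc i m) 0.
  rewrite sc0 (_ : (fun t : T => _) = cst 0%E).
    by rewrite integral_cst_probability mulr0; split=> //; exact: integrable0.
  by apply/funext => t; rewrite mulr0.
have [s sE] : exists s, esssupk k (mus 0%N) (ys i m) = s%:E.
  have := esssupk_ge0 k_gt0 (mus 0%N) (ys i m).
  move: Cfin; rewrite /C /score_sup -/(sc i m).
  case: (esssupk _ _ _) => [s _ _| |]; first by exists s.
    by rewrite gt0_mulye ?lte_fin ?normr_gt0// ltxx.
  by rewrite leeNy_eq.
have ks : \forall t \ae mu, `|k (t, ys i m)| <= s.
  apply: null_dominates_ae dom _.
  apply: filterS (ae_esssupk k (mus 0%N) (ys i m)) => t.
  by rewrite sE lee_fin gtr0_norm.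
have ik := integrable_ae_bounded (measurable_k1 k (ys i m)) ks.
rewrite (_ : (fun t : T => _) = fun t => (k (t, ys i m))%:E * (sc i m)%:E)%E//.
split; first exact: integrableZr.
rewrite integralZr// [RHS]EFinM; congr (_ * _)%E; rewrite /mixk fineK//.
exact: integrable_fin_num.
Qed.

Lemma integral_bhat (mu : probability T R) i : mu `<< mus 0%N ->
  (forall m, C i m < +oo)%E ->
  fine (\int[mu]_t (bhat k p alpha (mus i) (ys i) t)%:E)%E =
  M%:R^-1 * \sum_m mixk k mu (ys i m) * sc i m.
Proof.
move=> dom Cfin; under eq_integral do rewrite (bhatE k_gt0 alpha p_gt0) EFinM -sumEFin.
have int1 m := (integral_k_score dom (Cfin m)).1.
have int2 m := (integral_k_score dom (Cfin m)).2.
rewrite integralZl//; last by apply: integrable_sum => // m _; exact: int1.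
rewrite (@integral_sum _ _ _ mu _ measurableT 'I_M
  (fun m t => (k (t, ys i m) * sc i m)%:E))//.
under eq_bigr do rewrite int2.
by rewrite sumEFin.
Qed.

Lemma path_regret_le :
  ((\sum_(i < N) eta i * (M%:R^-1 * \sum_m
      regret_incr p alpha (ys i m) (q i m) (mixk k mustar (ys i m))))%R%:E
   <= KL mustar (mus 0%N)
      + \sum_(i < N) (eta i ^+ 2 / 2 * M%:R^-1)%:E * \sum_m C i m ^+ 2)%E.
Proof.
have C0 i m : (0 <= C i m)%E by exact: score_sup_ge0.
have Minv0 : (0 : R) < M%:R^-1 by rewrite invr_gt0 ltr0n.
have coef0 i : 0 < eta i ^+ 2 / 2 * M%:R^-1.
  by rewrite mulr_gt0// divr_gt0// exprn_gt0.
have sum0 i : (0 <= \sum_m C i m ^+ 2)%E by apply: sume_ge0 => m _; exact: sqre_ge0.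
(* One infinite bound makes the right-hand side +oo, since its coefficient is positive and all other
   terms are nonnegative. *)
have [/'forall_forallP Cfin|] :=
    boolP [forall i : 'I_N, forall m, (C i m < +oo)%E]; last first.
  move=> /forallPn[i /forallPn[m]]; rewrite -leNgt leye_eq => /eqP Cim.
  suff -> : (\sum_(i < N) (eta i ^+ 2 / 2 * M%:R^-1)%:E * \sum_m C i m ^+ 2 = +oo)%E.
    by rewrite addey ?leey// gt_eqF// (lt_le_trans _ (KL_ge0 mustar_dom))// ltNy0.
  rewrite (bigD1 i)//= (bigD1 m)//= Cim mulyy addye; last first.
    rewrite gt_eqF// (lt_le_trans ltNy0)//.
    by apply: sume_ge0 => j _; exact: mule_ge0.
  rewrite gt0_muley ?lte_fin// addye// gt_eqF// (lt_le_trans ltNy0)//.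
  by apply: sume_ge0 => j _; rewrite mule_ge0 ?lee_fin ?(ltW (coef0 j))//; exact: sum0.
(* By the triangle inequality the mean of the bounds on the M summands bounds [bhat]. *)
pose s i := M%:R^-1 * \sum_m fine (C i m).
have s0 i : 0 <= s i.
  by rewrite mulr_ge0 ?(ltW Minv0)// sumr_ge0// => m _; rewrite fine_ge0.
have CE (i : 'I_N) m : C i m = (fine (C i m))%:E.
  by rewrite fineK// ge0_fin_numE.
have bs i : (i < N)%N ->
    \forall t \ae mus 0%N, `|bhat k p alpha (mus i) (ys i) t| <= s i.
  move=> iN.
  have : \forall t \ae mus 0%N, forall m,
      ((k (t, ys i m) * `|sc i m|)%:E <= C i m)%E.
    by apply: filter_forall => m; exact: ae_bhat_le.
  apply: filterS => t kt; rewrite (bhatE k_gt0 alpha p_gt0) normrM gtr0_norm//.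
  rewrite ler_wpM2l ?(ltW Minv0)//; apply: le_trans (ler_norm_sum _ _ _) _.
  apply: ler_sum => m _; rewrite normrM gtr0_norm//.
  by have := kt m; rewrite (CE (Ordinal iN)) lee_fin.
have := @regret_le _ T R mus (fun i => bhat k p alpha (mus i) (ys i)) eta s N
  musS (fun i => ltW (eta_gt0 i)) s0 bs mustar mustar_dom.
rewrite (eq_bigr (fun i : 'I_N => eta i * (M%:R^-1 * \sum_m
    regret_incr p alpha (ys i m) (q i m) (mixk k mustar (ys i m))))); last first.
  move=> i _; rewrite !integral_bhat// -mulrBr -sumrB; congr (_ * (_ * _)).
  by apply: eq_bigr => m _; rewrite /regret_incr -/(sc i m) /q; ring.
move=> /le_trans; apply; rewrite leeD2l// -sumEFin; apply: lee_sum => i _.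
rewrite (eq_bigr (fun m => (fine (C i m) ^+ 2)%:E)); last first.
  by move=> m _; rewrite [C i m]CE -EFin_expe.
rewrite sumEFin -EFinM lee_fin exprMn mulrAC -[leRHS]mulrA.
rewrite ler_wpM2l ?divr_ge0 ?sqr_ge0//.
exact: (sqr_mean_le (fun m => fine (C i m))).
Qed.

End path_regret.

(** * Conditional densities and measurability of [muhat] *)

Section cond_density.
Local Open Scope ereal_scope.
Context (R : realType) (dO dF dY : measure_display).
Context (Omega : measurableType dO) (F : measurableType dF) (Y : measurableType dY).
Context (P : probability Omega R) (nu : {sigma_finite_measure set Y -> \bar R}).
Context (X : Omega -> F) (Z : Omega -> Y) (q : F * Y -> R).
Context (mX : measurable_fun [set: Omega] X) (mZ : measurable_fun [set: Omega] Z).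
Context (mq : measurable_fun [set: F * Y] q) (q_ge0 : forall z, (0 <= q z)%R).
Context (lawE : forall E A, measurable E -> measurable A ->
  P (X @^-1` E `&` Z @^-1` A)
  = \int[P]_(w in X @^-1` E) \int[nu]_(y in A) (q (X w, y))%:E).

Let mfX : {mfun Omega >-> F} := HB.pack X (isMeasurableFun.Build _ _ _ _ _ mX).

Let XZ (w : Omega) := (X w, Z w).

Let mXZ : measurable_fun [set: Omega] XZ.
Proof. exact: measurable_fun_pair. Qed.

Let mfXZ : {mfun Omega >-> (F * Y)%type} := HB.pack XZ (isMeasurableFun.Build _ _ _ _ _ mXZ).

Let PX : probability F R := distribution P mfX.
Let PXZ : probability (F * Y)%type R := distribution P mfXZ.

(** The joint law of X and Z has density [q] with respect to the product of the law of X and [nu]: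
    [lawE] says so on rectangles, a pi-system generating the product. Tonelli then splits the
    integral. *)
Lemma ge0_integral_cond_density (f : F * Y -> \bar R) :
  measurable_fun [set: F * Y] f -> (forall z, 0 <= f z) ->
  \int[P]_w f (X w, Z w) = \int[P]_w \int[nu]_y (f (X w, y) * (q (X w, y))%:E).
Proof.
move=> mf f0.
have mEq : measurable_fun [set: F * Y] (fun z => (q z)%:E) by exact/measurable_EFinP.
pose C := [set A `*` B | A in @measurable _ F & B in @measurable _ Y].
have PXZE S : measurable S -> PXZ S = mdensity (PX \x nu) q S.
  move=> mS; apply: (@measure_unique _ _ _ C (fun=> setT) _ _ _ _
    PXZ (mdensity_measure (PX \x nu) mq q_ge0)) => //.
  - exact: measurable_prod_measurableType.
  - move=> _ _ [A mA [B mB <-]] [A' mA' [B' mB' <-]]; rewrite -setXI.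
    by exists (A `&` A'); [exact: measurableI|exists (B `&` B') => //; exact: measurableI].
  - by move=> _; exists setT => //; exists setT => //; rewrite setXTT.
  - by rewrite bigcup_const//; exists 0%N.
  - move=> _ [A mA [B mB <-]]; transitivity (P (X @^-1` A `&` Z @^-1` B)).
      by [].
    rewrite lawE//= /mdensity [RHS]integral_mkcond fubini_tonelli1//; last 2 first.
    + apply/(measurable_restrictT _ _).1 => //; last exact: measurable_funTS.
      exact: measurableX.
    + by move=> z; rewrite /patch; case: ifP => // _; rewrite lee_fin.
    rewrite ge0_integral_pushforward//; last 2 first.
    + apply: measurable_fun_fubini_tonelli_F.
        apply/(measurable_restrictT _ _).1 => //; last exact: measurable_funTS.
        exact: measurableX.
      by move=> z; rewrite /patch; case: ifP => // _; rewrite lee_fin.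
    + move=> x _; apply: integral_ge0 => y _.
      by rewrite /patch; case: ifP => // _; rewrite lee_fin.
    rewrite preimage_setT [LHS]integral_mkcond; apply: eq_integral => w _.
    rewrite /patch /= /fubini_F.
    have -> : (w \in X @^-1` A) = (X w \in A) by apply/idP/idP; rewrite !inE.
    case: ifP => wA.
      rewrite [LHS]integral_mkcond; apply: eq_integral => y _.
      by rewrite /patch in_setX /= wA.
    by rewrite integral0_eq// => y _; rewrite in_setX /= wA.
  - by move=> _; rewrite [ltLHS](probability_setT PXZ) ltry.
transitivity (\int[PXZ]_z f z).
  by rewrite ge0_integral_distribution.
rewrite (@ge0_integral_density _ _ _ (PX \x nu) q)//.
have mfq : measurable_fun [set: F * Y] (fun z => f z * (q z)%:E).
  exact: emeasurable_funM.
have fq0 z : 0 <= f z * (q z)%:E by rewrite mule_ge0// lee_fin.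
rewrite fubini_tonelli1// ge0_integral_distribution//.
  exact: measurable_fun_fubini_tonelli_F.
by move=> x; apply: integral_ge0.
Qed.

Context (f : F * Y -> R) (K : R).
Context (mf : measurable_fun [set: F * Y] f).
Context (f_le : forall w, \int[nu]_y (`|f (X w, y)| * q (X w, y))%:E <= K%:E).

Let mfq : measurable_fun [set: F * Y] (fun z => (f z * q z)%:E).
Proof. by apply/measurable_EFinP; exact: measurable_funM. Qed.

Let mabs : measurable_fun [set: F * Y] (fun z => (`|f z|)%:E).
Proof. by apply/measurable_EFinP; exact: measurableT_comp. Qed.

Let mcomp_section (g : F * Y -> \bar R) w :
  measurable_fun setT g -> measurable_fun [set: Y] (fun y => g (X w, y)).
Proof. by move=> mg; exact: measurable_fun_pair2. Qed.

Lemma integrable_cond_density :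
  P.-integrable [set: Omega] (fun w => (f (X w, Z w))%:E).
Proof.
apply/integrableP; split.
  by apply/measurable_EFinP; exact: measurableT_comp mf mXZ.
rewrite (ge0_integral_cond_density mabs) => [|z]; last by rewrite lee_fin.
apply: (@le_lt_trans _ _ (\int[P]_w cst K%:E w)).
  by apply: le_integral_pointwise => w; exact: f_le.
by rewrite integral_cst_probability ltry.
Qed.

Let G w := \int[nu]_y (f (X w, y) * q (X w, y))%:E.

(** Serves for s the positive or the negative part, since Tonelli arguments want nonnegative
    integrands. *)
Let part (s : R -> R) w := \int[nu]_y ((s (f (X w, y)))%:E * (q (X w, y))%:E).

Let measurable_part (s : R -> R) : measurable_fun setT s -> (forall r, (0 <= s r)%R) ->
  measurable_fun [set: Omega] (part s).
Proof.
move=> ms s0.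
apply: (measurableT_comp (f := fubini_F nu (fun z => (s (f z))%:E * (q z)%:E)) _ mX).
apply: measurable_fun_fubini_tonelli_F.
  by apply: emeasurable_funM; apply/measurable_EFinP => //; exact: measurableT_comp.
by move=> z; rewrite mule_ge0// lee_fin.
Qed.

Let integrable_part (s : R -> R) : measurable_fun setT s -> (forall r, (0 <= s r <= `|r|)%R) ->
  P.-integrable [set: Omega] (part s).
Proof.
move=> ms sr; have s0 r : (0 <= s r)%R by case/andP: (sr r).
apply/integrableP; split; first exact: measurable_part.
apply: (@le_lt_trans _ _ (\int[P]_w cst K%:E w)).
  apply: le_integral_pointwise => w; rewrite gee0_abs; last first.
    by apply: integral_ge0 => y _; rewrite mule_ge0// lee_fin.
  apply: le_trans (f_le w); apply: le_integral_pointwise => y.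
  by rewrite -EFinM lee_fin ler_wpM2r//; case/andP: (sr (f (X w, y))).
by rewrite integral_cst_probability ltry.
Qed.

Let pos (r : R) := Num.max r 0%R.
Let neg (r : R) := Num.max (- r)%R 0%R.

Let mpos : measurable_fun setT pos. Proof. exact: measurable_maxr. Qed.
Let mneg : measurable_fun setT neg.
Proof. by apply: measurable_maxr => //; exact: measurable_funN. Qed.
Let pos_le r : (0 <= pos r <= `|r|)%R.
Proof. by rewrite /pos le_max lexx orbT /= ge_max normr_ge0 ler_norm. Qed.
Let neg_le r : (0 <= neg r <= `|r|)%R.
Proof. by rewrite /neg le_max lexx orbT /= ge_max normr_ge0 -normrN ler_norm. Qed.
Let posneg r : r = (pos r - neg r)%R.
Proof.
rewrite /pos /neg; have [r0|/ltW r0] := leP r 0%R.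
  by rewrite max_l ?oppr_ge0// sub0r opprK.
by rewrite max_r ?oppr_le0// subr0.
Qed.

Let GE w : G w = part pos w - part neg w.
Proof.
have isec (s : R -> R) : measurable_fun setT s -> (forall r, (0 <= s r <= `|r|)%R) ->
    nu.-integrable [set: Y] (fun y => (s (f (X w, y)))%:E * (q (X w, y))%:E).
  move=> ms sr.
  have sfq : measurable_fun [set: F * Y] (fun z => (s (f z))%:E * (q z)%:E).
    by apply: emeasurable_funM; apply/measurable_EFinP => //; exact: measurableT_comp.
  apply/integrableP; split; first exact: (mcomp_section w sfq).
  apply: (@le_lt_trans _ _ K%:E); last exact: ltry.
  apply: le_trans (f_le w); apply: le_integral_pointwise => y.
  have /andP[s0 s1] := sr (f (X w, y)).
  by rewrite -EFinM abse_EFin ger0_norm ?mulr_ge0// lee_fin ler_wpM2r.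
rewrite /G /part -integralB//; [|exact: isec..].
by apply: eq_integral => y _; rewrite -!EFinM -EFinB -mulrBl -posneg.
Qed.

Lemma integrable_cond_expectation : P.-integrable [set: Omega] G.
Proof.
rewrite (_ : G = part pos \- part neg); last by apply/funext => w; exact: GE.
by apply: integrableB => //; exact: integrable_part.
Qed.

(** Tower property, the source of unbiasedness: the nonnegative case applied to both parts of [f],
    whose integrals the uniform bound [f_le] keeps finite. *)
Lemma integral_cond_density : \int[P]_w (f (X w, Z w))%:E = \int[P]_w G w.
Proof.
have ipart (s : R -> R) : measurable_fun setT s -> (forall r, (0 <= s r <= `|r|)%R) ->
    P.-integrable [set: Omega] (fun w => (s (f (X w, Z w)))%:E).
  move=> ms sr; have := integrable_cond_density; apply: le_integrable => //.
    apply/measurable_EFinP; apply: measurableT_comp => //.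
    exact: measurableT_comp mf mXZ.
  move=> w _; have /andP[s0 s1] := sr (f (X w, Z w)).
  by rewrite !abse_EFin lee_fin ger0_norm.
transitivity (\int[P]_w (part pos w - part neg w)); last first.
  by apply: eq_integral => w _; rewrite GE.
rewrite integralB//; [|exact: integrable_part..].
transitivity (\int[P]_w ((pos (f (X w, Z w)))%:E - (neg (f (X w, Z w)))%:E)).
  by apply: eq_integral => w _; rewrite -EFinB -posneg.
rewrite integralB//; [|exact: ipart..].
congr (_ - _).
  apply: (ge0_integral_cond_density (f := fun z => (pos (f z))%:E)).
    by apply/measurable_EFinP; exact: measurableT_comp.
  by move=> z; rewrite lee_fin; case/andP: (pos_le (f z)).
apply: (ge0_integral_cond_density (f := fun z => (neg (f z))%:E)).
  by apply/measurable_EFinP; exact: measurableT_comp.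
by move=> z; rewrite lee_fin; case/andP: (neg_le (f z)).
Qed.

End cond_density.

(** * Measurability of [muhat] with respect to the past *)

Section muhat_density.
Context (R : realType) (dT dY dO : measure_display).
Context (T : measurableType dT) (Y : measurableType dY) (Omega : measurableType dO).
Context (k : {mfun (T * Y)%type >-> R}).
Context (k_gt0 : forall t y, 0 < k (t, y)).
Context (p : {mfun Y >-> R}) (alpha : R).
Context (p_gt0 : forall y, 0 < p y).
Context (mu1 : probability T R) (eta : nat -> R).
Context (M : nat) (Ys : 'I_M -> nat -> Omega -> Y).

Let F i := g_sigma_algebraType (past_events Ys i.+1).

(* The shift of indices by one puts the initial measure [mu1] at index 0. *)
Let mu i w : probability T R := muhat k p alpha mu1 eta Ys i.+1 w.

Let b i w : {mfun T >-> R} := bhat k p alpha (mu i w) (fun m => Ys m i.+2 w).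

Let z i w := exp_weighted (mu i w) (eta i.+1) (b i w) [set: T].

(** Mirrors [muhat] on every path, including its fallback to the previous measure when the
    normalizer is infinite, so that it is a density for all w. *)
Fixpoint dens (i : nat) (w : Omega) (t : T) : R :=
  if i is i'.+1 then
    if z i' w == +oo%E then dens i' w t
    else dens i' w t * expR (- eta i'.+1 * b i' w t) / fine (z i' w)
  else 1.

Lemma dens_ge0 i w t : 0 <= dens i w t.
Proof.
elim: i => [|i IH] //=; case: ifP => // _; rewrite mulr_ge0 ?mulr_ge0 ?expR_ge0//.
by rewrite invr_ge0 fine_ge0// measure_ge0.
Qed.

Lemma measurable_dens_section i w : measurable_fun [set: T] (dens i w).
Proof.
elim: i => [|i IH] /=; first exact: measurable_cst.
case: (z i w == +oo%E) => //; apply: measurable_funM => //.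
by apply: measurable_funM => //; exact: measurable_expR_mul.
Qed.

Lemma muhat_densE i w A : measurable A ->
  (muhat k p alpha mu1 eta Ys i.+1 w A = \int[mu1]_(t in A) (dens i w t)%:E)%E.
Proof.
elim: i A => [|i IH] A mA; first by rewrite [RHS](integral_cst mu1 mA 1%E) mul1e.
transitivity (mnormalize (exp_weighted (mu i w) (eta i.+1) (b i w)) (mu i w) A).
  by [].
have [zoo|zfin] := eqVneq (z i w) +oo%E.
  rewrite /mnormalize; case: ifPn => [_|/norP[_ /eqP/(_ zoo)]//]; rewrite [LHS]IH//.
  by apply: eq_integral => t _; rewrite /= zoo eqxx.
rewrite (mnormalize_density (measurable_dens_section i w) (dens_ge0 i w) IH)//.
  by apply: eq_integral => t _; rewrite /= (negPf zfin).
by rewrite ltey.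
Qed.

Lemma muhat_dominated i w : muhat k p alpha mu1 eta Ys i.+1 w `<< mu1.
Proof.
apply/null_content_dominatesP => A mA A0; rewrite muhat_densE//.
apply: null_set_integral => //.
exact/measurable_EFinP/measurable_funTS/measurable_dens_section.
Qed.

Lemma measurable_past_le i j : (i <= j)%N -> @measurable_fun _ _ (F j) (F i) setT id.
Proof.
move=> ij; apply: (@measurability _ _ (F j) (F i) _ _ (past_events Ys i.+1)) => //.
move=> _ [B [m [l [A [/andP[l2 li] mA ->]]]] <-]; rewrite setTI.
apply: sub_sigma_algebra; exists m, l, A; split=> //.
by rewrite l2 (leq_trans li).
Qed.

Lemma measurable_past_event i m : measurable_fun [set: F i.+1] (Ys m i.+2).
Proof.
move=> _ A mA; rewrite setTI; apply: sub_sigma_algebra.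
by exists m, i.+2, A; split; rewrite ?leqnn.
Qed.

(** The density replaces a measure depending on w by the fixed measure [mu1], to which Tonelli
    applies. *)
Lemma measurable_mixk_muhat i :
  measurable_fun [set: F i * T] (fun x => dens i x.1 x.2) ->
  measurable_fun [set: F i * Y] (fun x => mixk k (mu i x.1) x.2).
Proof.
move=> md.
pose f (x : F i * Y * T) := ((k (x.2, x.1.2))%:E * (dens i x.1.1 x.2)%:E)%E.
have mf : measurable_fun [set: F i * Y * T] f.
  apply: emeasurable_funM; apply/measurable_EFinP.
    apply: measurableT_comp => //; apply: measurable_fun_pair => //.
    exact: measurableT_comp measurable_snd measurable_fst.
  apply: (measurableT_comp md (g := fun x : F i * Y * T => (x.1.1, x.2))).
  apply: measurable_fun_pair => //.
  exact: measurableT_comp measurable_fst measurable_fst.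
have f0 x : (0 <= f x)%E by rewrite mule_ge0 ?lee_fin ?dens_ge0//; exact: k_ge0.
have -> : (fun x : F i * Y => mixk k (mu i x.1) x.2) = fine \o fubini_F mu1 f.
  apply/funext => -[w y] /=; rewrite /mixk /fubini_F; congr fine.
  apply: (@ge0_integral_density _ _ _ mu1 (dens i w)).
  - exact: measurable_dens_section.
  - by move=> t; exact: dens_ge0.
  - by move=> A mA; exact: muhat_densE.
  - exact/measurable_EFinP/measurable_k1.
  - by move=> t; exact: k_ge0.
by apply: measurableT_comp => //; exact: measurable_fun_fubini_tonelli_F.
Qed.

(** Each step feeds the next: density, mixture, [bhat] at the new draws, normalizer, new density. *)
Lemma measurable_dens i : measurable_fun [set: F i * T] (fun x => dens i x.1 x.2).
Proof.
elim: i => [|i IH]; first exact: measurable_cst.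
have md : measurable_fun [set: F i.+1 * T] (fun x => dens i x.1 x.2).
  (* Both [F i] and [F i.+1] have carrier [Omega]; the change of sigma-algebra is made explicit by
     composing with the identity. *)
  apply: (@measurableT_comp _ _ _ (F i.+1 * T)%type (F i * T)%type R
    (fun x => dens i x.1 x.2) _ (fun x => (x.1, x.2)) IH).
  apply: measurable_fun_pair => //.
  exact: (@measurableT_comp _ _ _ (F i.+1 * T)%type (F i.+1) (F i) id _ fst
    (measurable_past_le (leqnSn i)) measurable_fst).
have mY m : measurable_fun [set: F i.+1 * T] (fun x => Ys m i.+2 x.1).
  exact: (@measurableT_comp _ _ _ (F i.+1 * T)%type (F i.+1) Y (Ys m i.+2) _ fst
    (measurable_past_event m) measurable_fst).
have mb : measurable_fun [set: F i.+1 * T] (fun x => b i x.1 x.2).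
  rewrite (_ : (fun x => _) = fun x => M%:R^-1 * \sum_(m < M) k (x.2, Ys m i.+2 x.1) *
      score p alpha (Ys m i.+2 x.1) (mixk k (mu i x.1) (Ys m i.+2 x.1))); last first.
    by apply/funext => x; rewrite [LHS](bhatE k_gt0 alpha p_gt0).
  apply: measurable_funM => //; apply: measurable_sum => m.
  apply: measurable_funM.
    by apply: measurableT_comp => //; exact: measurable_fun_pair.
  apply: measurable_score => //.
  apply: (@measurableT_comp _ _ _ (F i.+1 * T)%type (F i * Y)%type R
    (fun x => mixk k (mu i x.1) x.2) _ (fun x => (x.1, Ys m i.+2 x.1))
    (measurable_mixk_muhat IH)).
  apply: measurable_fun_pair => //.
  exact: (@measurableT_comp _ _ _ (F i.+1 * T)%type (F i.+1) (F i) id _ fst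
    (measurable_past_le (leqnSn i)) measurable_fst).
have mg : measurable_fun [set: F i.+1 * T]
    (fun x => dens i x.1 x.2 * expR (- eta i.+1 * b i x.1 x.2)).
  apply: measurable_funM => //; apply: measurableT_comp => //.
  exact: measurable_funM.
have mz : measurable_fun [set: F i.+1] (z i).
  pose f (x : F i.+1 * T) := (dens i x.1 x.2 * expR (- eta i.+1 * b i x.1 x.2))%:E.
  have -> : z i = fubini_F mu1 f.
    apply/funext => w; rewrite /z (exp_weighted_density _ _
      (measurable_dens_section i w) (dens_ge0 i w) (muhat_densE i w))//.
  apply: measurable_fun_fubini_tonelli_F; first exact/measurable_EFinP.
  by move=> x; rewrite lee_fin mulr_ge0 ?dens_ge0 ?expR_ge0.
have mz1 : measurable_fun [set: F i.+1 * T] (fun x => z i x.1).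
  exact: measurableT_comp mz measurable_fst.
apply: measurable_fun_ifT => //.
  exact: measurable_fun_eqe.
apply: measurable_funM => //; apply: (measurableT_comp (@measurable_invr R)).
exact: measurableT_comp.
Qed.

End muhat_density.

(** * Finite-horizon bound *)

Section finite_horizon.
Context (R : realType) (dT dY : measure_display).
Context (T : measurableType dT) (Y : measurableType dY).
Context (nu : {sigma_finite_measure set Y -> \bar R}).
Context (k : {mfun (T * Y)%type >-> R}).
Context (k_gt0 : forall t y, 0 < k (t, y)).
Context (k_int : forall t, (\int[nu]_y (k (t, y))%:E = 1)%E).
Context (p : {mfun Y >-> R}) (alpha : R).
Context (p_gt0 : forall y, 0 < p y).
Context (M : nat) (M_gt0 : (0 < M)%N).
Context (mu1 mustar : probability T R).
Context (B_fin : (Bsq nu k p alpha < +oo)%E).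
Context (mustar_dom : mustar `<< mu1).

Lemma Bsq_ge0 : (0 <= Bsq nu k p alpha)%E.
Proof.
apply: le_trans (integral_score_sup_sq nu k_gt0 mu1 alpha p_gt0 mu1).
by apply: integral_ge0 => y _; rewrite mule_ge0 ?sqre_ge0// lee_fin mixk_ge0.
Qed.

Section sampling.
Context (eta : nat -> R) (eta_gt0 : forall n, (0 < n)%N -> 0 < eta n).
Context (dO : measure_display) (Omega : measurableType dO).
Context (P : probability Omega R) (Ys : 'I_M -> nat -> {RV P >-> Y}).
Context (Ys_iid : cond_iid_sampling nu k p alpha mu1 eta Ys).

Let G i := past_events (fun m n => Ys m n : Omega -> Y) i.+1.
Let F i := g_sigma_algebraType (G i).

Let mu i w : probability T R :=
  muhat k p alpha mu1 eta (fun m n => Ys m n : Omega -> Y) i.+1 w.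

Let mu_dom i w : mu i w `<< mu1.
Proof. exact: muhat_dominated. Qed.

(** The identity into [Omega] with the sigma-algebra of the past: the past becomes a random
    variable, and conditioning on it a statement about a joint law. *)
Let X i (w : Omega) : F i := w.

Let mX i : measurable_fun [set: Omega] (X i).
Proof.
apply: (@measurability _ _ Omega (F i) _ _ (G i)) => //.
move=> _ [B [m [l [A [_ mA ->]]]] <-]; rewrite setTI.
have mYs : measurable_fun [set: Omega] (Ys m l) by exact: measurable_funPT.
by have := mYs measurableT A mA; rewrite setTI.
Qed.

Let Z m i : Omega -> Y := Ys m i.+2.

Let mZ m i : measurable_fun [set: Omega] (Z m i).
Proof. exact: measurable_funPT. Qed.

Let q i (x : F i * Y) : R := mixk k (mu i x.1) x.2.

Let mq i : measurable_fun [set: F i * Y] (@q i).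
Proof.
exact: (measurable_mixk_muhat k_gt0 (@measurable_dens _ _ _ _ _ _ _ _ k_gt0 p alpha
  p_gt0 mu1 eta _ (fun m n => Ys m n : Omega -> Y) i)).
Qed.

Let q_ge0 i x : 0 <= @q i x.
Proof. exact: mixk_ge0. Qed.

Let lawE i m (E : set (F i)) (A : set Y) : measurable E -> measurable A ->
  (P (X i @^-1` E `&` Z m i @^-1` A)
   = \int[P]_(w in X i @^-1` E) \int[nu]_(y in A) (q (X i w, y))%:E)%E.
Proof.
move=> mE mA.
(* The other draws are left free; their factors are total masses, equal to 1. *)
pose A' m' := if m' == m then A else setT.
have mA' m' : measurable (A' m') by rewrite /A'; case: ifP.
have [_ /(_ E mE) H] := @Ys_iid i.+1 isT A' mA'.
have cap : Z m i @^-1` A = \bigcap_m' (Ys m' i.+2 @^-1` A' m').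
  apply/seteqP; split => w /=.
    by move=> Aw m' _; rewrite /A' /=; case: ifPn => // /eqP ->.
  by move=> /(_ m I); rewrite /A' eqxx.
rewrite cap [LHS]H; apply: eq_integral => w _.
rewrite (bigD1 m)//= big1 ?mule1; last first.
  by move=> m' /negPf m'm; rewrite /A' m'm; exact: (integral_mixk k_gt0 k_int (mu i w)).
by rewrite /A' eqxx.
Qed.

Let f i (x : F i * Y) : R :=
  regret_incr p alpha x.2 (q x) (mixk k mustar x.2).

Let mf i : measurable_fun [set: F i * Y] (@f i).
Proof.
apply: measurable_funM; first exact: measurable_score.
apply: measurable_funB => //.
exact: measurableT_comp (measurable_mixk k_gt0 mustar) measurable_snd.
Qed.

Let K : R := fine (Bsq nu k p alpha + 1)%E.

Let KE : (Bsq nu k p alpha + 1)%E = K%:E.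
Proof.
rewrite /K fineK// ge0_fin_numE ?adde_ge0 ?Bsq_ge0//.
by rewrite lte_add_pinfty ?ltry.
Qed.

Let f_le i w : (\int[nu]_y (`|@f i (X i w, y)| * q (X i w, y))%:E <= K%:E)%E.
Proof.
rewrite -KE.
apply: le_trans (integral_score_sup_mixk k_gt0 k_int alpha p_gt0 mu1 (mu i w)).
apply: le_integral_pointwise => y.
have := incr_le k_gt0 p alpha y (mu_dom i w) mustar_dom.
rewrite /= normrM (ger0_norm (mixk_ge0 k_gt0 (mu i w) y)); exact.
Qed.

Let gap i w := lin_gap nu k p alpha (mu i w) mustar.

Let int_gap i : P.-integrable [set: Omega] (gap i).
Proof.
exact: (integrable_cond_expectation P (@mX i) (@mq i) (@q_ge0 i) (@mf i) (@f_le i)).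
Qed.

(** By [integral_f] it is also the expected increment of each of the M draws. *)
Let e i : R := fine (\int[P]_w gap i w).

Let eE i : (\int[P]_w gap i w)%E = (e i)%:E.
Proof. by rewrite /e fineK//; exact: integrable_fin_num (int_gap i). Qed.

Let int_f i m : P.-integrable [set: Omega] (fun w => (@f i (X i w, Z m i w))%:E).
Proof.
exact: (integrable_cond_density (@mX i) (@mZ m i) (@mq i) (@q_ge0 i)
  (@lawE i m) (@mf i) (@f_le i)).
Qed.

Let integral_f i m : (\int[P]_w (@f i (X i w, Z m i w))%:E = (e i)%:E)%E.
Proof.
rewrite -eE; exact: (integral_cond_density (@mX i) (@mZ m i) (@mq i) (@q_ge0 i)
  (@lawE i m) (@mf i) (@f_le i)).
Qed.

Let C2 i (x : F i * Y) : \bar R := (score_sup k mu1 p alpha x.2 (q x) ^+ 2)%E.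

Let C2_ge0 i x : (0 <= @C2 i x)%E. Proof. exact: sqre_ge0. Qed.

Let mC2 i : measurable_fun [set: F i * Y] (@C2 i).
Proof.
rewrite /C2; under eq_fun do rewrite expe2.
by apply: emeasurable_funM; exact: measurable_score_sup.
Qed.

Let integral_C2 i m : (\int[P]_w @C2 i (X i w, Z m i w) <= Bsq nu k p alpha)%E.
Proof.
rewrite (ge0_integral_cond_density (@mX i) (@mZ m i) (@mq i) (@q_ge0 i)
  (@lawE i m) (@mC2 i) (@C2_ge0 i)).
rewrite -[leRHS](integral_cst_probability P); apply: le_integral_pointwise => w.
exact: (integral_score_sup_sq nu k_gt0 mu1 alpha p_gt0 (mu i w)).
Qed.

Let mC2w i m : measurable_fun [set: Omega] (fun w => @C2 i (X i w, Z m i w)).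
Proof.
exact: (measurableT_comp (@mC2 i) (measurable_fun_pair (@mX i) (@mZ m i))).
Qed.

Let path w N :
  ((\sum_(i < N) eta i.+1 * (M%:R^-1 * \sum_m @f i (X i w, Z m i w)))%R%:E
   <= KL mustar mu1
      + \sum_(i < N) (eta i.+1 ^+ 2 / 2 * M%:R^-1)%:E
          * \sum_m @C2 i (X i w, Z m i w))%E.
Proof.
exact: (@path_regret_le _ _ _ _ _ _ k_gt0 p alpha p_gt0 M M_gt0 (mu ^~ w) mustar
  (fun i m => Z m i w) (fun i => eta i.+1) N (fun i => eta_gt0 (ltn0Sn i))
  (fun _ _ => erefl) mustar_dom (mu_dom ^~ w)).
Qed.

(** Expectation of the pathwise regret; the M draws contribute equally to each sum, which cancels
    the factor 1 / M. *)
Let sum_e N : (KL mustar mu1 < +oo)%E ->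
  ((\sum_(i < N) eta i.+1 * e i)%R%:E
   <= KL mustar mu1 + Bsq nu k p alpha * (\sum_(i < N) eta i.+1 ^+ 2 / 2)%R%:E)%E.
Proof.
move=> KLfin.
have M0 : (0 : R) < M%:R by rewrite ltr0n.
have coef0 i : 0 <= eta i.+1 ^+ 2 / 2 * M%:R^-1.
  by rewrite mulr_ge0 ?invr_ge0 ?ler0n// divr_ge0// sqr_ge0.
have intsum i : P.-integrable [set: Omega]
    (fun w => (\sum_m @f i (X i w, Z m i w))%:E).
  by under eq_fun do rewrite -sumEFin; apply: integrable_sum => // m _; exact: int_f.
have termE i : (fun w => (eta i.+1 * (M%:R^-1 * \sum_m @f i (X i w, Z m i w)))%:E)
    = (fun w => (eta i.+1 * M%:R^-1)%:E * (\sum_m @f i (X i w, Z m i w))%:E)%E.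
  by apply/funext => w; rewrite -EFinM; congr EFin; ring.
have -> : ((\sum_(i < N) eta i.+1 * e i)%R%:E = \int[P]_w
   (\sum_(i < N) eta i.+1 * (M%:R^-1 * \sum_m @f i (X i w, Z m i w)))%R%:E)%E.
  under eq_integral do rewrite -sumEFin.
  rewrite (@integral_sum _ _ _ P _ measurableT 'I_N
    (fun i w => (eta i.+1 * (M%:R^-1 * \sum_m @f i (X i w, Z m i w)))%:E)); last first.
    by move=> i; rewrite termE; exact: integrableZl.
  rewrite -sumEFin; apply: eq_bigr => i _.
  rewrite termE integralZl//; under eq_integral do rewrite -sumEFin.
  rewrite (@integral_sum _ _ _ P _ measurableT 'I_M
    (fun m w => (@f i (X i w, Z m i w))%:E)) => [|m]; last exact: int_f.
  under eq_bigr do rewrite integral_f.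
  rewrite sumEFin sumr_const card_ord -EFinM -[e i *+ M]mulr_natl; congr EFin.
  by field; rewrite gt_eqF.
apply: (le_trans (le_integral_pointwise _ (path ^~ N))).
have mS i : measurable_fun [set: Omega] (fun w => \sum_m @C2 i (X i w, Z m i w))%E.
  by apply: emeasurable_sum => m; exact: mC2w.
have S0 i w : (0 <= \sum_m @C2 i (X i w, Z m i w))%E.
  by apply: sume_ge0 => m _; exact: C2_ge0.
rewrite ge0_integralD//; last 3 first.
- by move=> w _; exact: KL_ge0.
- by move=> w _; apply: sume_ge0 => i _; rewrite mule_ge0// lee_fin.
- by apply: emeasurable_sum => i; exact: emeasurable_funM.
rewrite [X in (X + _)%E](integral_cst_probability P) leeD2l//.
rewrite ge0_integral_sum//; last 2 first.
- by move=> i; exact: emeasurable_funM.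
- by move=> i w _; rewrite mule_ge0// lee_fin.
rewrite -sumEFin ge0_sume_distrr; last first.
  by move=> i _; rewrite lee_fin divr_ge0// sqr_ge0.
apply: lee_sum => i _; rewrite ge0_integralZl//; last by rewrite lee_fin.
rewrite ge0_integral_sum//.
apply: (@le_trans _ _ ((eta i.+1 ^+ 2 / 2 * M%:R^-1)%:E *
    \sum_(m < M) Bsq nu k p alpha)%E).
  rewrite lee_wpmul2l ?lee_fin//; apply: lee_sum => m _; exact: integral_C2.
have /fineK <- : Bsq nu k p alpha \is a fin_num.
  by rewrite ge0_fin_numE// Bsq_ge0.
rewrite sumEFin sumr_const card_ord -!EFinM lee_fin -[fine _ *+ M]mulr_natl.
by rewrite mulrA divfK ?gt_eqF// mulrC.
Qed.

Lemma expected_gap_le N : (0 < N)%N ->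
  (expected_gap nu k p alpha mu1 mustar eta P Ys N
   <= gap_bound (Balpha nu k p alpha) (KL mustar mu1) eta N)%E.
Proof.
move=> N0; rewrite /expected_gap /gap_bound.
rewrite (_ : Balpha nu k p alpha = sqrte (Bsq nu k p alpha))//.
rewrite sqr_sqrte ?Bsq_ge0// big_add1 big_mkord.
set S := \sum_(1 <= n < N.+1) eta n.
have SE : S = \sum_(i < N) eta i.+1 by rewrite /S big_add1 big_mkord.
have S0 : 0 < S.
  rewrite SE; case: N N0 {SE S} => // N _; rewrite big_ord_recl ltr_pwDl ?eta_gt0//.
  by apply: sumr_ge0 => i _; rewrite ltW// eta_gt0.
have num0 : (0 <= Bsq nu k p alpha * (\sum_(i < N) eta i.+1 ^+ 2 / 2)%R%:E)%E.
  apply: mule_ge0; first exact: Bsq_ge0.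
  by rewrite lee_fin; apply: sumr_ge0 => i _; rewrite divr_ge0// sqr_ge0.
have [KLoo|KLfin] := eqVneq (KL mustar mu1) +oo%E.
  rewrite KLoo gt0_mulye ?lte_fin ?invr_gt0// addey ?leey//.
  by rewrite gt_eqF// (lt_le_trans ltNy0)// mule_ge0// lee_fin invr_ge0 ltW.
(* Steps are counted from 1 in the statement and from 0 here, hence [i.+1]. *)
have a0 i : 0 <= eta i.+1 / S by rewrite divr_ge0 ?ltW// eta_gt0.
pose a i : {nonneg R} := NngNum (a0 i).
have avgE w : weighted_average eta
    (fun n => muhat k p alpha mu1 eta (fun m n => Ys m n : Omega -> Y) n w) N
    = msum (fun i => mscale (a i) (mu i w)) N.
  by apply/funext => A; rewrite /weighted_average big_add1 big_mkord.
have a1 : \sum_(i < N) (a i)%:num = 1.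
  by rewrite /= -mulr_suml -SE mulfV// gt_eqF.
apply: (@le_trans _ _ (\int[P]_w \sum_(i < N) (a i)%:num%:E * gap i w)%E).
  apply: le_integral_pointwise => w; rewrite avgE.
  exact: (Psi_gap_le k_gt0 k_int p_gt0 B_fin (mu_dom ^~ w) mustar_dom a1).
rewrite (@integral_sum _ _ _ P _ measurableT 'I_N
    (fun i w => (a i)%:num%:E * gap i w)%E); last first.
  by move=> i; apply: integrableZl.
have -> : (\sum_(i < N) \int[P]_w ((a i)%:num%:E * gap i w)
    = (\sum_(i < N) eta i.+1 * e i)%R%:E * (S^-1)%:E)%E.
  rewrite -EFinM mulr_suml -sumEFin; apply: eq_bigr => i _.
  by rewrite integralZl// eE -EFinM /= mulrAC.
have KLfin' : (KL mustar mu1 < +oo)%E by rewrite ltey.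
rewrite addeC -ge0_muleDl ?KL_ge0//.
by rewrite lee_wpmul2r ?lee_fin ?invr_ge0 ?(ltW S0)//; exact: sum_e.
Qed.

End sampling.
End finite_horizon.

(** * Learning-rate policies *)

(** Each new term 1 / (N + 1) is at most ln ((N + 1) / N), by ln x <= x - 1 at x = N / (N + 1). *)
Lemma harmonic_le_ln (R : realType) (N : nat) : (0 < N)%N ->
  \sum_(i < N) (i.+1%:R : R)^-1 <= 1 + ln N%:R.
Proof.
case: N => // N _; elim: N => [|N IH].
  by rewrite big_ord_recl big_ord0 invr1 ln1 !addr0.
rewrite big_ord_recr /=; apply: (le_trans (lerD IH (lexx _))).
rewrite -addrA lerD2l -lerBrDl -ln_div ?posrE ?ltr0n//.
have pos : (0 : R) < N.+1%:R / N.+2%:R by rewrite divr_gt0 ?ltr0n.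
have := ln_le_subr1 pos.
rewrite -[N.+2%:R / _]invf_div lnV ?posrE// => H.
rewrite lerNr; apply: (le_trans H).
have n2 : N.+2%:R != 0 :> R by rewrite pnatr_eq0.
rewrite le_eqVlt; apply/orP; left; apply/eqP.
by field.
Qed.

(** Every term is at least the last one, and N / sqrt N = sqrt N. *)
Lemma sum_inv_sqrt_ge (R : realType) (N : nat) :
  Num.sqrt N%:R <= \sum_(i < N) (Num.sqrt i.+1%:R : R)^-1.
Proof.
case: N => [|N]; first by rewrite sqrtr0 big_ord0.
have s0 n : (0 : R) < Num.sqrt n.+1%:R by rewrite sqrtr_gt0 ltr0n.
apply: (@le_trans _ _ (\sum_(i < N.+1) (Num.sqrt N.+1%:R : R)^-1)); last first.
  by apply: ler_sum => i _; rewrite lef_pV2 ?posrE// ler_wsqrtr// ler_nat.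
rewrite sumr_const card_ord -[leRHS]mulr_natl ler_pdivlMr//.
by rewrite -expr2 sqr_sqrtr// ler0n.
Qed.

Section policies.
Context (R : realType) (b kappa eta0 : R).
Context (b_ge0 : 0 <= b) (kappa_ge0 : 0 <= kappa) (eta0_gt0 : 0 < eta0).

(** Real form of [gap_bound], with b for the square of [Balpha] and kappa for the divergence. *)
Definition real_bound (eta : nat -> R) (N : nat) : R :=
  let S := \sum_(1 <= n < N.+1) eta n in
  b * (\sum_(1 <= n < N.+1) eta n ^+ 2 / 2) / S + kappa / S.

Lemma gap_boundE (eta : nat -> R) N :
  gap_bound (sqrte b%:E) kappa%:E eta N = (real_bound eta N)%:E.
Proof. by rewrite /gap_bound sqr_sqrte. Qed.

Lemma constant_policyE N : (0 < N)%N ->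
  real_bound (constant_policy eta0 N) N
  = (b * eta0 / 2 + kappa / eta0) / Num.sqrt N%:R.
Proof.
move=> N0; rewrite /real_bound /constant_policy !big_add1 !big_mkord.
have sumE c : \sum_(i < N) c = N%:R * c :> R.
  by rewrite sumr_const card_ord mulr_natl.
rewrite !sumE.
have s0 : 0 < Num.sqrt (N%:R : R) by rewrite sqrtr_gt0 ltr0n.
have -> : N%:R = Num.sqrt N%:R ^+ 2 :> R by rewrite sqr_sqrtr// ler0n.
rewrite sqrtr_sqr ger0_norm ?sqrtr_ge0//.
by field; rewrite !gt_eqF.
Qed.

Lemma decreasing_policy_le N : (0 < N)%N ->
  real_bound (decreasing_policy eta0) N
  <= (b * eta0 / 2 * (1 + ln N%:R) + kappa / eta0) / Num.sqrt N%:R.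
Proof.
move=> N0; rewrite /real_bound /decreasing_policy !big_add1 !big_mkord.
have s0 : 0 < Num.sqrt (N%:R : R) by rewrite sqrtr_gt0 ltr0n.
have -> : \sum_(i < N) eta0 / Num.sqrt i.+1%:R =
    eta0 * \sum_(i < N) (Num.sqrt i.+1%:R)^-1 by rewrite mulr_sumr.
have -> : \sum_(i < N) (eta0 / Num.sqrt i.+1%:R) ^+ 2 / 2 =
    eta0 ^+ 2 / 2 * \sum_(i < N) (i.+1%:R)^-1.
  rewrite mulr_sumr; apply: eq_bigr => i _.
  by rewrite expr_div_n sqr_sqrtr ?ler0n// mulrAC.
set S := \sum_(i < N) (Num.sqrt i.+1%:R)^-1.
set H := \sum_(i < N) (i.+1%:R)^-1.
have HS : Num.sqrt N%:R <= S by exact: sum_inv_sqrt_ge.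
have HH : H <= 1 + ln N%:R by exact: harmonic_le_ln.
have S0 : 0 < S := lt_le_trans s0 HS.
have -> : b * (eta0 ^+ 2 / 2 * H) / (eta0 * S) + kappa / (eta0 * S)
    = (b * eta0 / 2 * H + kappa / eta0) / S.
  by field; rewrite !gt_eqF.
have c0 : 0 <= b * eta0 / 2 by rewrite divr_ge0// mulr_ge0// ltW.
have ln0 : 0 <= ln N%:R :> R by rewrite ln_ge0// ler1n.
apply: ler_pM.
- have H0 : 0 <= H by apply: sumr_ge0 => i _; rewrite invr_ge0 ler0n.
  by apply: addr_ge0; [exact: mulr_ge0|apply: divr_ge0 => //; exact: ltW].
- by rewrite invr_ge0 ltW.
- by rewrite lerD2r ler_wpM2l.
- by rewrite lef_pV2.
Qed.

Lemma real_bound_ge0 (eta : nat -> R) N :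
  (forall n, (0 < n)%N -> 0 <= eta n) -> 0 <= real_bound eta N.
Proof.
move=> eta_ge0; rewrite /real_bound !big_add1 !big_mkord.
have S0 : 0 <= \sum_(i < N) eta i.+1 by apply: sumr_ge0 => i _; exact: eta_ge0.
rewrite addr_ge0 ?divr_ge0// mulr_ge0// sumr_ge0// => i _.
by rewrite divr_ge0// sqr_ge0.
Qed.

Lemma decreasing_policy_bigO :
  (real_bound (decreasing_policy eta0) : nat -> R^o) =O_\oo
    ((fun N => ln N%:R / Num.sqrt N%:R) : nat -> R^o).
Proof.
(* Once ln N >= 1, both 1 + ln N <= 2 ln N and 1 <= ln N hold, which gives the first two terms; the
   last keeps the constant positive. *)
apply/eqO_exP; exists (b * eta0 + kappa / eta0 + 1).
  by rewrite ltr_wpDl// addr_ge0// ?divr_ge0 ?mulr_ge0// ltW.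
near=> N.
have N0 : (0 < N)%N by near: N; exists 1%N.
have ln1N : 1 <= ln N%:R :> R.
  rewrite -[leLHS]expRK ler_ln ?posrE ?expR_gt0 ?ltr0n//.
  by near: N; exact: nbhs_infty_ger.
have s0 : 0 < Num.sqrt (N%:R : R) by rewrite sqrtr_gt0 ltr0n.
rewrite !ger0_norm; last 2 first.
- by rewrite divr_ge0 ?sqrtr_ge0// (le_trans ler01).
- apply: real_bound_ge0 => n _.
  by rewrite /decreasing_policy divr_ge0 ?sqrtr_ge0// ltW.
apply: (le_trans (decreasing_policy_le N0)).
rewrite mulrA ler_wpM2r ?invr_ge0 ?sqrtr_ge0//.
have : 0 <= b * eta0 by rewrite mulr_ge0// ltW.
have : 0 <= kappa / eta0 by rewrite divr_ge0// ltW.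
by nra.
Unshelve. all: by end_near.
Qed.

Lemma constant_policy_bigO (c : R) : 0 <= c ->
  ((fun N => c / Num.sqrt N%:R) : nat -> R^o) =O_\oo
    ((fun N => (Num.sqrt N%:R)^-1) : nat -> R^o).
Proof.
move=> c0; apply/eqO_exP; exists (c + 1); first by rewrite ltr_wpDl.
near=> N; rewrite normrM (ger0_norm c0) ler_wpM2r//.
by rewrite lerDl.
Unshelve. all: by end_near.
Qed.

(** Completing the square with s = sqrt (2 kappa): the objective is beta s + (beta eta - s)^2 / (2
    eta), and the square vanishes at eta = s / beta. *)
Lemma optimal_constant_policy (beta eta : R) : b = beta ^+ 2 -> 0 < beta ->
  0 < kappa -> 0 < eta ->
  let etastar := beta^-1 * Num.sqrt (2 * kappa) in
  b * etastar / 2 + kappa / etastar <= b * eta / 2 + kappa / eta.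
Proof.
move=> -> beta0 kappa0 e0 /=.
set s := Num.sqrt (2 * kappa).
have s0 : 0 < s by rewrite sqrtr_gt0 mulr_gt0.
have -> : kappa = s ^+ 2 / 2.
  rewrite sqr_sqrtr; last by rewrite mulr_ge0// ltW.
  by rewrite mulrC mulKf.
have -> : beta ^+ 2 * (beta^-1 * s) / 2 + s ^+ 2 / 2 / (beta^-1 * s) = beta * s.
  by field; rewrite !gt_eqF.
have -> : beta ^+ 2 * eta / 2 + s ^+ 2 / 2 / eta
    = beta * s + (beta * eta - s) ^+ 2 / (2 * eta).
  by field; rewrite gt_eqF.
by rewrite lerDl divr_ge0 ?sqr_ge0// mulr_ge0// ltW.
Qed.

End policies.

Theorem theorem5 (R : realType) (dT dY : measure_display)
  (T : measurableType dT) (Y : measurableType dY)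
  (nu : {sigma_finite_measure set Y -> \bar R})
  (k : {mfun (T * Y)%type >-> R}) (K : R.-pker T ~> Y) (p : {mfun Y >-> R})
  (alpha : R) (M : nat) (mu1 mustar : probability T R)
  (K_density : forall t A, measurable A ->
     K t A = (\int[nu]_(y in A) (k (t, y))%:E)%E)
  (k_gt0 : forall t y, 0 < k (t, y))
  (p_gt0 : forall y, 0 < p y)
  (p_int : (\int[nu]_y (p y)%:E < +oo)%E)
  (b1_fin : alpha = 1 -> forall (mu : probability T R) (t : T),
     balpha nu k p alpha mu t \is a fin_num)
  (M_gt0 : (0 < M)%N)
  (B_fin : (Balpha nu k p alpha < +oo)%E)
  (mustar_dom : mustar `<< mu1)
  (mustar_opt : Psi nu k p alpha mustar =
     ereal_inf [set Psi nu k p alpha zeta |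
       zeta in [set zeta : probability T R | zeta `<< mu1]]) :
  let B := Balpha nu k p alpha in
  let KLstar := KL mustar mu1 in
  [/\ (* general learning rates *)
      forall eta : nat -> R, (forall n, (0 < n)%N -> 0 < eta n) ->
      forall (dO : measure_display) (Omega : measurableType dO)
        (P : probability Omega R) (Ys : 'I_M -> nat -> {RV P >-> Y}),
      cond_iid_sampling nu k p alpha mu1 eta Ys ->
      forall N, (0 < N)%N ->
      (expected_gap nu k p alpha mu1 mustar eta P Ys N
         <= gap_bound B KLstar eta N)%E,
      (* decreasing policy *)
      forall eta0 : R, 0 < eta0 -> (KLstar < +oo)%E ->
      exists2 g : nat -> R,
        (g : nat -> R^o) =O_\oo
          ((fun N => ln N%:R / Num.sqrt N%:R) : nat -> R^o) &
        forall (dO : measure_display) (Omega : measurableType dO)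
          (P : probability Omega R) (Ys : 'I_M -> nat -> {RV P >-> Y}),
        cond_iid_sampling nu k p alpha mu1 (decreasing_policy eta0) Ys ->
        forall N, (0 < N)%N ->
        (expected_gap nu k p alpha mu1 mustar (decreasing_policy eta0) P Ys N
           <= (g N)%:E)%E,
      (* constant policy *)
      forall eta0 : R, 0 < eta0 -> (KLstar < +oo)%E ->
      exists g : nat -> R,
        [/\ (g : nat -> R^o) =O_\oo
              ((fun N => (Num.sqrt N%:R)^-1) : nat -> R^o),
            forall N, (0 < N)%N ->
              gap_bound B KLstar (constant_policy eta0 N) N = (g N)%:E &
            forall N, (0 < N)%N ->
            forall (dO : measure_display) (Omega : measurableType dO)
              (P : probability Omega R) (Ys : 'I_M -> nat -> {RV P >-> Y}),
            cond_iid_sampling nu k p alpha mu1 (constant_policy eta0 N) Ys ->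
            (expected_gap nu k p alpha mu1 mustar (constant_policy eta0 N) P Ys N
               <= (g N)%:E)%E] &
      (* optimal constant policy *)
      (0 < B)%E -> (0 < KLstar)%E -> (KLstar < +oo)%E ->
      let eta0star := (fine B)^-1 * Num.sqrt (2 * fine KLstar) in
      0 < eta0star /\
      forall N, (0 < N)%N -> forall eta0 : R, 0 < eta0 ->
      (gap_bound B KLstar (constant_policy eta0star N) N
         <= gap_bound B KLstar (constant_policy eta0 N) N)%E].

Proof.
have k_int t : (\int[nu]_y (k (t, y))%:E = 1)%E.
  by rewrite -K_density// prob_kernel.
have BE : Balpha nu k p alpha = sqrte (Bsq nu k p alpha) by [].
have Bsq0 : (0 <= Bsq nu k p alpha)%E := Bsq_ge0 nu k_gt0 alpha p_gt0 mu1.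
have Bsq_fin : Bsq nu k p alpha \is a fin_num.
  by rewrite -sqrte_fin_num// -BE ge0_fin_numE// BE sqrte_ge0.
have Bsq_lty : (Bsq nu k p alpha < +oo)%E by rewrite -ge0_fin_numE.
set b := fine (Bsq nu k p alpha).
have bE : Bsq nu k p alpha = b%:E by rewrite /b fineK.
have b0 : 0 <= b by rewrite /b fine_ge0.
have KL0 : (0 <= KL mustar mu1)%E by exact: KL_ge0.
have finite_bound eta := @expected_gap_le _ _ _ _ _ nu k k_gt0 k_int p alpha p_gt0
  M M_gt0 mu1 mustar Bsq_lty mustar_dom eta.
move=> B KLstar.
set kappa := fine KLstar.
have kappa0 : 0 <= kappa by rewrite /kappa fine_ge0.
have KLE : (KLstar < +oo)%E -> KLstar = kappa%:E.
  by move=> KLoo; rewrite /kappa fineK// ge0_fin_numE.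
have boundE eta N : (KLstar < +oo)%E ->
    gap_bound B KLstar eta N = (real_bound b kappa eta N)%:E.
  by move=> /KLE ->; rewrite /B BE bE gap_boundE.
have constE eta0 N : (KLstar < +oo)%E -> 0 < eta0 -> (0 < N)%N ->
    gap_bound B KLstar (constant_policy eta0 N) N =
    ((b * eta0 / 2 + kappa / eta0) / Num.sqrt N%:R)%:E.
  by move=> KLoo e0 N0; rewrite boundE// constant_policyE.
split.
- move=> eta eta_gt0 dO Omega P Ys iid N N0.
  exact: (finite_bound eta eta_gt0 dO Omega P Ys iid N N0).
(* The witness is the general bound itself, real because [Balpha] and the divergence are finite. *)
- move=> eta0 e0 KLoo; exists (real_bound b kappa (decreasing_policy eta0)).
    exact: decreasing_policy_bigO.
  move=> dO Omega P Ys iid N N0; rewrite -boundE//.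
  apply: (finite_bound _ _ dO Omega P Ys iid N N0) => n n0.
  by rewrite /decreasing_policy divr_gt0// sqrtr_gt0 ltr0n.
- move=> eta0 e0 KLoo.
  exists (fun N => (b * eta0 / 2 + kappa / eta0) / Num.sqrt N%:R); split.
  + apply: constant_policy_bigO.
    by apply: addr_ge0; apply: divr_ge0 => //; [apply: mulr_ge0 => //|]; exact: ltW.
  + by move=> N N0; rewrite constE.
  + move=> N N0 dO Omega P Ys iid; rewrite -constE//.
    apply: (finite_bound _ _ dO Omega P Ys iid N N0) => n n0.
    by rewrite /constant_policy divr_gt0// sqrtr_gt0 ltr0n.
- move=> Bgt0 KLgt0 KLoo eta0star.
  have betaE : b = fine B ^+ 2.
    have Bfin : B \is a fin_num by rewrite ge0_fin_numE// ltW.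
    have : (B ^+ 2 = b%:E)%E by rewrite /B BE sqr_sqrte.
    by rewrite -(fineK Bfin) -EFin_expe => -[].
  have beta_gt0 : 0 < fine B by rewrite fine_gt0// Bgt0.
  have kappa_gt0 : 0 < kappa by rewrite /kappa fine_gt0// KLgt0.
  have star_gt0 : 0 < eta0star.
    by rewrite /eta0star mulr_gt0 ?invr_gt0// sqrtr_gt0 mulr_gt0.
  split=> // N N0 eta0 e0; rewrite !constE// lee_fin ler_wpM2r//.
  exact: optimal_constant_policy.
Qed.
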